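(* Let $u=u(x,t)$ be a solution of the initial value problem associated to the Camassa-Holm equation $$\partial_tu+u\,\partial_xu+\partial_x(1-\partial_x^2)^{-1}\Big(u^2+\tfrac12(\partial_xu)^2\Big)=0,\qquad x\in\mathbb R,$$ in the class $$u\in C([-T,T]:H^1(\mathbb R))\cap C^1((-T,T):L^2(\mathbb R))\cap L^\infty([-T,T]:W^{1,\infty}(\mathbb R)).$$ If there exist $t_0\in(-T,T)$ and $a,b\in\mathbb R$ with $a<b$ such that $$u(x,t_0)=0,\qquad x\in[a,b],$$ and $$\partial_tu(x,t_0)\ \text{ is not strictly decreasing on }[a,b],$$ then $u\equiv0$.
   Context: $W^{1,\infty}(\mathbb R)$ is the space of real functions $f$ with $f,\partial_xf\in L^\infty(\mathbb R)$. The operator is $\partial_x(1-\partial_x^2)^{-1}g=K*g$ with $K(x)=-\tfrac12\,\mathrm{sgn}(x)e^{-|x|}$. It is known (Linares-Ponce-Sideris) that for every $u_0\in X\equiv H^1(\mathbb R)\cap W^{1,\infty}(\mathbb R)$ there exist $T=T(\|u_0\|_X)>0$ and a unique solution of the Camassa-Holm equation $\partial_tu+u\,\partial_xu+\partial_x(1-\partial_x^2)^{-1}\big(u^2+\tfrac12(\partial_xu)^2\big)=0$ with $u(\cdot,0)=u_0$ in the class $C([-T,T]:H^1(\mathbb R))\cap C^1((-T,T):L^2(\mathbb R))\cap L^\infty([-T,T]:W^{1,\infty}(\mathbb R))$; the solution in the claim is such a solution. Under the hypothesis $u(\cdot,t_0)=0$ on $[a,b]$, the function $\partial_tu(\cdot,t_0)$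 is continuous on $[a,b]$, so its pointwise values there make sense. *)

(* Defs.v *)
From HB Require Import structures.
From mathcomp Require Import all_boot all_order all_algebra.
From mathcomp Require Import all_classical all_reals all_analysis.
Import Order.TTheory GRing.Theory Num.Theory.
Import numFieldNormedType.Exports.

Set Implicit Arguments.
Unset Strict Implicit.
Unset Printing Implicit Defensive.

Local Open Scope classical_set_scope.
Local Open Scope ring_scope.

Section CamassaHolm.
Context {R : realType}.
Implicit Types (f g phi : R -> R) (p : \bar R) (u ut : R -> R -> R).

Local Notation mu := (@lebesgue_measure R).

(* C_c^oo(R); throughout, [u t] is the function u(., t) *)
Definition test_function phi : Prop :=
  (forall (n : nat) (x : R), derivable (derive1n n phi) x 1) /\
  compact (closure [set x | phi x != 0]).

Definition is_weak_derivative f g : Prop :=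
  [/\ locally_integrable setT f, locally_integrable setT g &
      forall phi, test_function phi ->
        \int[mu]_x (f x * phi^`()%classic x) = - \int[mu]_x (g x * phi x)].

(* A representative of the weak derivative, which is unique up to equality
   almost everywhere; 0 if there is none. *)
Definition weak_derive f : R -> R :=
  xget (fun _ => 0) [set g | is_weak_derivative f g].

(* W^{1,p}(R) *)
Definition in_W1 p f : Prop :=
  f \in Lfun mu p /\ exists2 g, is_weak_derivative f g & g \in Lfun mu p.

Definition in_H1 f : Prop := in_W1 2%:E f.

Definition in_W1oo f : Prop := in_W1 +oo%E f.

Definition L2_norm f : \bar R := 'N[mu]_2%:E[EFin \o f]%E.

Definition Loo_norm f : \bar R := 'N[mu]_+oo%E[EFin \o f]%E.

Definition H1_norm f : \bar R :=
  ((L2_norm f ^+ 2 + L2_norm (weak_derive f) ^+ 2) `^ 2^-1)%E.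

Definition W1oo_norm f : \bar R :=
  (Loo_norm f + Loo_norm (weak_derive f))%E.

(* u \in C([-T,T] : H^1(R)) *)
Definition in_C_H1 (T : R) u : Prop :=
  forall t : R, t \in `[- T, T] ->
    in_H1 (u t) /\
    H1_norm (u s \- u t) @[s --> within `[- T, T] (nbhs t)] --> 0%E.

(* u \in C^1((-T,T) : L^2(R)), with time derivative ut *)
Definition in_C1_L2 (T : R) u ut : Prop :=
  forall t : R, t \in `]- T, T[ ->
    [/\ u t \in Lfun mu 2%:E,
        ut t \in Lfun mu 2%:E,
        L2_norm (fun x => h^-1 * (u (t + h) x - u t x) - ut t x)
          @[h --> 0^'] --> 0%E &
        L2_norm (ut s \- ut t) @[s --> t] --> 0%E].

(* u \in L^oo([-T,T] : W^{1,oo}(R)) *)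
Definition in_Loo_W1oo (T : R) u : Prop :=
  exists M : R, {ae mu, forall t : R, t \in `[- T, T] ->
    in_W1oo (u t) /\ (W1oo_norm (u t) <= M%:E)%E}.

(* The kernel of d/dx (1 - d^2/dx^2)^{-1}. *)
Definition CH_kernel (x : R) : R := - 2^-1 * Num.sg x * expR (- `|x|).

Definition convolution f g (x : R) : R := \int[mu]_y (f (x - y) * g y).

(* u solves the Camassa-Holm initial value problem with datum u0 on [-T,T];
   ut is its time derivative. Elements of H^1(R) are represented by their
   continuous representatives, so that the values u t x are meaningful;
   the equation is an identity in L^2(R) at each time of (-T,T). *)
Record CH_solution (T : R) (u0 : R -> R) u ut : Prop := {
  CH_datum : in_H1 u0 /\ in_W1oo u0;
  CH_initial : {ae mu, forall x, u 0 x = u0 x};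
  CH_continuous : forall t : R, t \in `[- T, T] -> continuous (u t);
  CH_C_H1 : in_C_H1 T u;
  CH_C1_L2 : in_C1_L2 T u ut;
  CH_Loo_W1oo : in_Loo_W1oo T u;
  CH_equation : forall t : R, t \in `]- T, T[ ->
    let ux := weak_derive (u t) in
    {ae mu, forall x, ut t x + u t x * ux x
      + convolution CH_kernel (fun y => u t y ^+ 2 + 2^-1 * ux y ^+ 2) x = 0}
}.

(* The pointwise values on [a,b] of a function f given up to equality almost
   everywhere are those of its continuous representative v there. *)
Definition strictly_decreasing_on (a b : R) f : Prop :=
  exists v : R -> R,
    [/\ {within `[a, b], continuous v},
        {ae mu, forall x : R, x \in `[a, b] -> f x = v x} &
        {in `[a, b] &, forall x y, x < y -> v y < v x}].

End CamassaHolm.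

(* Main.v *)
(* On the gap [a, b] both u(t0) and its derivative vanish, so the equation reads
   ut = - K * G there, with G = u^2 + ux^2 / 2 >= 0 supported outside the gap, and
   - (K * G)(x) = (A e^-x - B e^x) / 2, where A, B >= 0 are the exponentially
   weighted masses of G to the left and to the right of the gap. This is strictly
   decreasing unless A = B = 0, in which case u(t0) = 0.

   A solution vanishing at one time vanishes at all times: let E = |u|^2 + |ux|^2
   (L^2 norms) and E_h = |u|^2 + |D_h u|^2, with D_h the difference quotient in x.
   Unlike E, E_h is differentiable in time for u in C^1(L^2), and |E_h'| <= C E
   uniformly in h: the transport term is an exact derivative up to ux times a
   square, and the nonlocal term is bounded by Schur's test because D_h K is
   bounded in L^1. Since E <= sup_h E_h, a bound E <= B near a zero of u improves
   to E <= B / 2 on an interval of fixed length, so the set of times where u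
   vanishes is open; it is also closed.

   Weak derivatives are turned into primitives of bounded functions by testing
   against smooth approximations of the indicator of an interval. *)
Require Import Defs.
From mathcomp Require Import all_boot all_order all_algebra.
From mathcomp Require Import all_classical all_reals all_analysis.
From mathcomp Require Import measurable_realfun ess_sup_inf.
From mathcomp Require Import ring lra.
Import Order.TTheory GRing.Theory Num.Theory.
Import numFieldNormedType.Exports.

Set Implicit Arguments.
Unset Strict Implicit.
Unset Printing Implicit Defensive.

Local Open Scope classical_set_scope.
Local Open Scope ring_scope.

(** Difference quotients in x are forced by the time regularity: u is C^1 in time only with values
    in L^2, so its slope need not have a time derivative. For a fixed h, Gronwall's lemma does not
    close, because the nonlocal term bounds the derivative of E_h by the full E and not by E_h. So
    the estimate is used between t and s for each h with a constant free of h, then h is removed,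
    and only then is the result iterated: on one interval |s - t| < d with C d <= 1/2, starting from
    E <= 1 (continuity in H^1), this gives E <= 2^-n for every n. The constant C depends only on a
    bound M for |u| and |ux|. The hypotheses supply such a bound for almost every time only;
    continuity in L^2 carries it to every time of the open interval. Weak derivatives are arbitrary
    representatives, so each slice is given a derivative bounded by M at every point, which makes
    the product rule and the estimates pointwise. *)

#[global] Instance ae_lebesgue_filter (R : realType) :
  Filter (almost_everywhere (@lebesgue_measure R)).
Proof. exact: ae_filter_ringOfSetsType. Qed.

(** * Translations and convolutions for the Lebesgue measure *)

Section LebesgueIsometry.
Context {R : realType}.
Notation mu := (@lebesgue_measure R).
Implicit Types (f g : R -> R) (A : set R) (h c x y : R).

Lemma measurable_shift h : measurable_fun [set: R] (fun x => x + h).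
Proof. by apply: measurable_funD. Qed.

Lemma measurable_reflect c : measurable_fun [set: R] (fun x => c - x).
Proof. by apply: measurable_funB. Qed.

Lemma preimage_shift_ocitv h a b :
  (fun x => x + h) @^-1` `]a, b] = `]a - h, b - h]%classic :> set R.
Proof.
by apply/seteqP; split => x /=; rewrite !in_itv /= ltrBlDr lerBrDr.
Qed.

(** The image measure under the translation gives half-open intervals their length, and this
    property characterises Lebesgue measure. *)
Lemma lebesgue_measure_shift h A : measurable A ->
  mu ((fun x => x + h) @^-1` A) = mu A.
Proof.
move=> mA; pose f : measurableTypeR R -> measurableTypeR R := fun x => x + h.
have mf : measurable_fun setT f by exact: measurable_shift.
rewrite -[LHS]/(pushforward mu f A); apply/esym.
apply: (lebesgue_measure_unique (mu := pushforward mu f)) => //.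
move=> _ [[a b] _ <-] /=; rewrite /pushforward /f preimage_shift_ocitv.
rewrite !lebesgue_measure_itv /= !lte_fin ltrD2r.
by case: ifP => // _; rewrite -!EFinB; congr (_%:E); ring.
Qed.

Lemma lebesgue_measure_reflect c A : measurable A ->
  mu ((fun x => c - x) @^-1` A) = mu A.
Proof.
move=> mA; pose f : measurableTypeR R -> measurableTypeR R := fun x => c - x.
have mf : measurable_fun setT f by exact: measurable_reflect.
rewrite -[LHS]/(pushforward mu f A); apply/esym.
apply: (lebesgue_measure_unique (mu := pushforward mu f)) => //.
move=> _ [[a b] _ <-] /=; rewrite /pushforward /f.
(* Reflection exchanges the open and the closed endpoint, which does not affect the length. *)
have -> : (fun x => c - x) @^-1` `]a, b] = `[c - b, c - a[%classic.
  by apply/seteqP; split => x /=; rewrite !in_itv /=; lra.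
rewrite !lebesgue_measure_itv /= !lte_fin ltrD2l ltrN2.
by case: ifP => // _; rewrite -!EFinB; congr (_%:E); ring.
Qed.

Lemma ge0_integral_shift (f : R -> \bar R) h : measurable_fun setT f ->
  (forall x, 0 <= f x)%E -> (\int[mu]_x f (x + h)%R = \int[mu]_x f x)%E.
Proof.
move=> mf f0; pose s : measurableTypeR R -> measurableTypeR R := fun x => x + h.
have ms : measurable_fun setT s by exact: measurable_shift.
transitivity (\int[pushforward mu s]_x f x)%E.
  by rewrite ge0_integral_pushforward.
by apply: eq_measure_integral => A mA _; exact: lebesgue_measure_shift.
Qed.

Lemma ge0_integral_reflect (f : R -> \bar R) c : measurable_fun setT f ->
  (forall x, 0 <= f x)%E -> (\int[mu]_x f (c - x)%R = \int[mu]_x f x)%E.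
Proof.
move=> mf f0; pose s : measurableTypeR R -> measurableTypeR R := fun x => c - x.
have ms : measurable_fun setT s by exact: measurable_reflect.
transitivity (\int[pushforward mu s]_x f x)%E.
  by rewrite ge0_integral_pushforward.
by apply: eq_measure_integral => A mA _; exact: lebesgue_measure_reflect.
Qed.

Lemma integrable_shift f h : mu.-integrable setT (EFin \o f) ->
  mu.-integrable setT (EFin \o (fun x => f (x + h))).
Proof.
move=> /integrableP[mf fy]; apply/integrableP; split.
  exact: (measurableT_comp mf (measurable_shift h)).
rewrite (ge0_integral_shift (f := fun x => `|(f x)%:E|%E)) //.
exact: measurableT_comp.
Qed.

Lemma Rintegral_shift f h : mu.-integrable setT (EFin \o f) ->
  \int[mu]_x f (x + h) = \int[mu]_x f x.
Proof.
move=> fi; pose s : measurableTypeR R -> measurableTypeR R := fun x => x + h.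
have ms : measurable_fun setT s by exact: measurable_shift.
have fi' := integrable_shift h fi.
rewrite /Rintegral; congr fine.
transitivity (\int[pushforward mu s]_x (f x)%:E)%E.
  rewrite integral_pushforward //.
  by case/integrableP: fi.
by apply: eq_measure_integral => A mA _; exact: lebesgue_measure_shift.
Qed.

Lemma ae_shift (P : R -> Prop) h : {ae mu, forall x, P x} ->
  {ae mu, forall x, P (x + h)}.
Proof.
move=> [N [mN N0 PN]]; exists ((fun x => x + h) @^-1` N); split.
- by rewrite -[_ @^-1` _]setTI; exact: measurable_shift.
- by rewrite lebesgue_measure_shift.
- by move=> x /= Px; exact: PN.
Qed.

End LebesgueIsometry.

(** * Integrability and integrals of convolutions *)

Section Convolution.
Context {R : realType}.
Notation mu := (@lebesgue_measure R).
Implicit Types (k q f g : R -> R).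

Lemma measurable_conv_kernel k q : measurable_fun setT k ->
  measurable_fun setT q ->
  measurable_fun [set: R * R] (fun z => k (z.1 - z.2) * q z.2).
Proof.
move=> mk mq; apply: measurable_funM.
  by apply: (measurableT_comp mk); exact: measurable_funB.
exact: (measurableT_comp mq).
Qed.

Lemma tonelli_conv k q : measurable_fun setT k -> measurable_fun setT q ->
  (forall x, 0 <= k x) -> (forall x, 0 <= q x) ->
  (\int[mu]_x \int[mu]_y (k (x - y) * q y)%R%:E =
   (\int[mu]_x (k x)%:E) * \int[mu]_y (q y)%:E)%E.
Proof.
move=> mk mq k0 q0.
transitivity (\int[mu]_y \int[mu]_x (k (x - y) * q y)%R%:E)%E.
  apply: (fubini_tonelli (m1 := mu) (m2 := mu)
    (fun z : R * R => (k (z.1 - z.2) * q z.2)%:E)).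
  - by apply/measurable_EFinP; exact: measurable_conv_kernel.
  - by move=> z; rewrite lee_fin mulr_ge0.
transitivity (\int[mu]_y ((\int[mu]_x (k x)%:E) * (q y)%:E))%E.
  apply: eq_integral => y _.
  rewrite -(@ge0_integral_shift R (EFin \o k) (- y)) //; last first.
    exact/measurable_EFinP.
  under eq_integral do rewrite EFinM.
  rewrite ge0_integralZr //.
  - apply/measurable_EFinP; exact: (measurableT_comp mk (measurable_shift _)).
  - by move=> x _; rewrite lee_fin.
  - by rewrite lee_fin.
rewrite ge0_integralZl //.
- exact/measurable_EFinP.
- by move=> x _; rewrite lee_fin.
- by apply: integral_ge0 => x _; rewrite lee_fin.
Qed.

(** Tonelli applied to |k| and |q| gives the product of the two L^1 norms, which is finite. *)
Lemma integrable_conv_kernel k q : mu.-integrable setT (EFin \o k) ->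
  mu.-integrable setT (EFin \o q) ->
  (mu \x mu)%E.-integrable [set: R * R] (fun z => (k (z.1 - z.2) * q z.2)%:E).
Proof.
move=> /integrableP[mk ky] /integrableP[mq qy].
move/measurable_EFinP: (mk) => mk'; move/measurable_EFinP: (mq) => mq'.
apply/(integrable12ltyP mu mu) => /=.
  by apply/measurable_EFinP; exact: measurable_conv_kernel.
under eq_integral do under eq_integral do rewrite normrM.
rewrite (tonelli_conv (k := fun x => `|k x|) (q := fun x => `|q x|)) //.
- by rewrite lte_mul_pinfty // ?ge0_fin_numE //; exact: integral_ge0.
- exact: measurableT_comp.
- exact: measurableT_comp.
Qed.

Lemma measurable_convolution k q : mu.-integrable setT (EFin \o k) ->
  mu.-integrable setT (EFin \o q) -> measurable_fun setT (convolution k q).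
Proof.
move=> ik iq; have := measurable_fubini_F (integrable_conv_kernel ik iq).
move=> mF; exact: (measurableT_comp (@fine_measurable R setT measurableT) mF).
Qed.

Lemma integrable_convolution k q : mu.-integrable setT (EFin \o k) ->
  mu.-integrable setT (EFin \o q) ->
  mu.-integrable setT (EFin \o convolution k q).
Proof.
move=> ik iq; have iF := integrable_fubini_F (integrable_conv_kernel ik iq).
apply: (le_integrable measurableT _ _ iF).
  by apply/measurable_EFinP; exact: measurable_convolution.
(* [fine] sends an infinite inner integral to 0, so the domination also holds at such points. *)
move=> x _ /=; rewrite /convolution /Rintegral /fubini_F /=.
by case: (\int[mu]_y _)%E => [r| |] //=; rewrite ?normr0 ?leey.
Qed.

Lemma Rintegral_convolution k q : mu.-integrable setT (EFin \o k) ->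
  mu.-integrable setT (EFin \o q) ->
  \int[mu]_x convolution k q x = \int[mu]_x k x * \int[mu]_x q x.
Proof.
move=> ik iq; have ikq := integrable_conv_kernel ik iq.
transitivity (fine (\int[mu]_x \int[mu]_y (k (x - y) * q y)%R%:E)%E).
  rewrite /Rintegral; congr fine; apply: ae_eq_integral => //.
  - by apply/measurable_EFinP; exact: measurable_convolution.
  - exact: measurable_fubini_F ikq.
  have := ae_integrable1 ikq; apply: filterS => x ix _ /=.
  by rewrite /convolution /Rintegral fineK //; exact: integrable_fin_num.
rewrite (Fubini ikq) /=.
transitivity (fine (\int[mu]_y ((\int[mu]_x k x)%:E * (q y)%:E))%E).
  congr fine; apply: eq_integral => y _.
  rewrite -(@Rintegral_shift R k (- y)) // -EFinM.
  rewrite -RintegralZr //; last exact: integrable_shift.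
  rewrite fineK //; apply: integrable_fin_num => //.
  have := integrable_shift (- y) ik => /(integrableZr measurableT (q y)).
  by apply: eq_integrable.
rewrite (integralZl measurableT iq) fineM //.
exact: integrable_fin_num.
Qed.

End Convolution.

(** * Square-integrable functions *)

Section SquareIntegrable.
Context {R : realType}.
Notation mu := (@lebesgue_measure R).
Implicit Types (f g v : R -> R) (a c h x y : R).

Definition integ f : Prop := mu.-integrable setT (EFin \o f).

Definition L2 f : Prop :=
  measurable_fun setT f /\ integ (fun x => f x ^+ 2).

(** The squared L^2 norm as a real number. It takes the value 0 when the integral is infinite, so it
    is informative only together with [L2 f]. *)
Definition sq f : R := \int[mu]_x (f x ^+ 2).

Definition ip f g : R := \int[mu]_x (f x * g x).

Lemma integ_measurable f : integ f -> measurable_fun setT f.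
Proof. by move=> /integrableP[/measurable_EFinP]. Qed.

Lemma integD f g : integ f -> integ g -> integ (fun x => f x + g x).
Proof. by move=> fi gi; exact: (integrableD measurableT fi gi). Qed.

Lemma integZ c f : integ f -> integ (fun x => c * f x).
Proof. by move=> fi; exact: (integrableZl measurableT c fi). Qed.

Lemma integB f g : integ f -> integ g -> integ (fun x => f x - g x).
Proof. by move=> fi gi; exact: (integrableB measurableT fi gi). Qed.

Lemma integ_le g f : measurable_fun setT f -> integ g ->
  (forall x, `|f x| <= g x) -> integ f.
Proof.
move=> mf ig fg; apply: (le_integrable measurableT _ _ ig).
  exact/measurable_EFinP.
by move=> x _ /=; rewrite lee_fin (le_trans (fg x)) // ler_norm.
Qed.

Lemma integ_norm f : integ f -> integ (fun x => `|f x|).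
Proof. by move=> fi; exact: (integrable_norm fi). Qed.

Lemma integ_boundM c f g : measurable_fun setT f -> integ g ->
  (forall x, `|f x| <= c) -> integ (fun x => f x * g x).
Proof.
move=> mf ig fc; apply: (@integ_le (fun x => c * `|g x|)).
- by apply: measurable_funM => //; exact: integ_measurable.
- exact/integZ/integ_norm.
- by move=> x; rewrite normrM ler_wpM2r.
Qed.

Lemma ae_eq_Rintegral f g : measurable_fun setT f -> measurable_fun setT g ->
  {ae mu, forall x, f x = g x} -> \int[mu]_x f x = \int[mu]_x g x.
Proof.
move=> mf mg fg; rewrite /Rintegral; congr fine.
apply: ae_eq_integral => //; try exact/measurable_EFinP.
by apply: filterS fg => x fg _ /=; rewrite fg.
Qed.

Lemma ae_eq_integ f g : measurable_fun setT g -> integ f ->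
  {ae mu, forall x, f x = g x} -> integ g.
Proof.
move=> mg fi fg; apply/integrableP; split; first exact/measurable_EFinP.
case/integrableP: fi => mf; congr (_ < _)%E.
apply: ae_eq_integral => //.
- exact: measurableT_comp.
- by apply: measurableT_comp => //; exact/measurable_EFinP.
- by apply: filterS fg => x fg _ /=; rewrite fg.
Qed.

Lemma le_normr_Rint f g : integ f -> integ g ->
  (forall x, `|f x| <= g x) -> `|\int[mu]_x f x| <= \int[mu]_x g x.
Proof.
move=> fi gi fg; apply: le_trans (le_normr_Rintegral measurableT fi) _.
by apply: le_Rintegral => //; exact: integ_norm.
Qed.

Lemma L2_measurable f : L2 f -> measurable_fun setT f.
Proof. by case. Qed.

Lemma ip_integ f g : L2 f -> L2 g -> integ (fun x => f x * g x).
Proof.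
move=> [mf fi] [mg gi].
apply: (@integ_le (fun x => 2^-1 * (f x ^+ 2 + g x ^+ 2))).
- exact: measurable_funM.
- exact/integZ/integD.
- move=> x; rewrite normrM.
  have := sqr_ge0 (`|f x| - `|g x|); rewrite -[f x ^+ 2]real_normK ?num_real //.
  rewrite -[g x ^+ 2]real_normK ?num_real //; nra.
Qed.

Lemma L2D f g : L2 f -> L2 g -> L2 (fun x => f x + g x).
Proof.
move=> Lf Lg; split; first exact: measurable_funD Lf.1 Lg.1.
have -> : (fun x => (f x + g x) ^+ 2) =
  (fun x => f x ^+ 2 + g x ^+ 2 + 2 * (f x * g x)).
  by apply/funext => x; ring.
by apply: integD; [exact: integD Lf.2 Lg.2|exact/integZ/ip_integ].
Qed.

Lemma L2Z c f : L2 f -> L2 (fun x => c * f x).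
Proof.
move=> Lf; split; first by apply: measurable_funM => //; exact: Lf.1.
have -> : (fun x => (c * f x) ^+ 2) = (fun x => c ^+ 2 * f x ^+ 2).
  by apply/funext => x; ring.
exact: integZ Lf.2.
Qed.

Lemma L2B f g : L2 f -> L2 g -> L2 (fun x => f x - g x).
Proof.
move=> Lf Lg; have := L2D Lf (L2Z (-1) Lg).
by under [X in L2 X]eq_fun do rewrite mulN1r.
Qed.

Lemma L2_shift h f : L2 f -> L2 (fun x => f (x + h)).
Proof.
move=> [mf fi]; split; first exact: (measurableT_comp mf (measurable_shift h)).
exact: (integrable_shift h fi).
Qed.

Lemma L2_le c f g : measurable_fun setT f -> L2 g ->
  (forall x, `|f x| <= c * `|g x|) -> L2 f.
Proof.
move=> mf [mg gi] fg; split => //.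
apply: (@integ_le (fun x => c ^+ 2 * g x ^+ 2)).
- exact: measurable_funX.
- exact: integZ.
- move=> x; rewrite normrX -[g x ^+ 2]real_normK ?num_real // -exprMn.
  rewrite lerXn2r // nnegrE //.
  exact: le_trans (fg x).
Qed.

Lemma ae_eq_L2 f g : measurable_fun setT g -> L2 f ->
  {ae mu, forall x, f x = g x} -> L2 g.
Proof.
move=> mg [mf fi] fg; split => //.
apply: ae_eq_integ fi _; first exact: measurable_funX.
by apply: filterS fg => x ->.
Qed.

Lemma sq_ge0 f : 0 <= sq f.
Proof. by apply: Rintegral_ge0 => x _; exact: sqr_ge0. Qed.

Lemma ae_eq_sq f g : measurable_fun setT f -> measurable_fun setT g ->
  {ae mu, forall x, f x = g x} -> sq f = sq g.
Proof.
move=> mf mg fg; apply: ae_eq_Rintegral; try exact: measurable_funX.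
by apply: filterS fg => x ->.
Qed.

Lemma sqE f : L2 f -> (\int[mu]_x (f x ^+ 2)%:E)%E = (sq f)%:E.
Proof. by case=> mf fi; rewrite /sq /Rintegral fineK // integrable_fin_num. Qed.

Lemma sq_shift h f : L2 f -> sq (fun x => f (x + h)) = sq f.
Proof. by case=> mf fi; exact: (Rintegral_shift h fi). Qed.

Lemma sqD f g : L2 f -> L2 g ->
  sq (fun x => f x + g x) = sq f + 2 * ip f g + sq g.
Proof.
move=> Lf Lg; rewrite /sq /ip.
rewrite -RintegralZl //; last exact: ip_integ.
rewrite -RintegralD //; last 2 first.
- exact: Lf.2.
- exact/integZ/ip_integ.
rewrite -RintegralD //; last 2 first.
- by apply: integD; [exact: Lf.2|exact/integZ/ip_integ].
- exact: Lg.2.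
by apply: eq_Rintegral => x _; ring.
Qed.

Lemma sqZ c f : L2 f -> sq (fun x => c * f x) = c ^+ 2 * sq f.
Proof.
move=> Lf; rewrite /sq -RintegralZl //; last exact: Lf.2.
by apply: eq_Rintegral => x _; ring.
Qed.

Lemma sqD_le f g : L2 f -> L2 g ->
  sq (fun x => f x + g x) <= 2 * sq f + 2 * sq g.
Proof.
move=> Lf Lg; have := sq_ge0 (fun x => f x + -1 * g x).
rewrite sqD //; last exact: L2Z.
have -> : ip f (fun x => -1 * g x) = - ip f g.
  rewrite -[RHS]mulN1r /ip -RintegralZl //; last exact: ip_integ.
  by apply: eq_Rintegral => x _; ring.
rewrite sqZ // sqD //; lra.
Qed.

Lemma ipDr f g v : L2 f -> L2 g -> L2 v ->
  ip f (fun x => g x + v x) = ip f g + ip f v.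
Proof.
move=> Lf Lg Lv; rewrite /ip -RintegralD //; try exact: ip_integ.
by apply: eq_Rintegral => x _; ring.
Qed.

Lemma ipZr c f g : L2 f -> L2 g -> ip f (fun x => c * g x) = c * ip f g.
Proof.
move=> Lf Lg; rewrite /ip -RintegralZl //; last exact: ip_integ.
by apply: eq_Rintegral => x _; ring.
Qed.

(** The polynomial t |-> [sq (f + t g)] is nonnegative; its value at the vertex t = - b / c is (a c
    - b^2) / c. *)
Lemma ip_CS f g : L2 f -> L2 g -> ip f g ^+ 2 <= sq f * sq g.
Proof.
move=> Lf Lg; pose a := sq f; pose b := ip f g; pose c := sq g.
have H t : 0 <= a + 2 * (t * b) + t ^+ 2 * c.
  have := sq_ge0 (fun x => f x + t * g x).
  by rewrite sqD ?sqZ ?ipZr //; exact: L2Z.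
have c0 : 0 <= c by exact: sq_ge0.
rewrite -/a -/b -/c; have [c_eq0|c_neq0] := eqVneq c 0; last first.
  have {}c0 : 0 < c by rewrite lt_neqAle eq_sym c_neq0.
  have := H (- b / c).
  have -> : a + 2 * (- b / c * b) + (- b / c) ^+ 2 * c = (a * c - b ^+ 2) / c.
    by field.
  by rewrite pmulr_lge0 ?invr_gt0 // subr_ge0.
have [->|b0] := eqVneq b 0; first by rewrite c_eq0 mulr0 expr0n.
(* With c = 0 the polynomial is affine with slope 2 b; at this t it would equal -1. *)
have := H (- (a + 1) / (2 * b)); rewrite c_eq0 mulr0 addr0.
have -> : a + 2 * (- (a + 1) / (2 * b) * b) = -1 by field.
by rewrite lerNr oppr0 ler10.
Qed.

Lemma Lfun2P f : f \in Lfun mu 2%:E <-> L2 f.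
Proof.
split.
  move=> /andP[/set_mem /= mf /set_mem /=]; rewrite /finite_norm => fy.
  split => //; apply/integrableP; split.
    exact/measurable_EFinP/measurable_funX.
  have := poweR_lty 2 fy; rewrite poweR_Lnorm ?pnatr_eq0 //.
  congr (_ < _)%E; apply: eq_integral => x _ /=.
  rewrite powR_mulrn // real_normK ?num_real //.
  by rewrite ger0_norm ?sqr_ge0.
move=> [mf /integrableP[_ fy]]; apply/andP; split; first by rewrite inE.
rewrite inE /= /finite_norm unlock /=.
apply: poweR_lty; move: fy; congr (_ < _)%E; apply: eq_integral => x _ /=.
rewrite powR_mulrn // real_normK ?num_real //.
by rewrite ger0_norm ?sqr_ge0.
Qed.

Lemma L2_normE f : L2 f -> L2_norm f = (Num.sqrt (sq f))%:E.
Proof.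
move=> Lf; rewrite /L2_norm unlock /=.
transitivity ((sq f)%:E `^ 2^-1)%E.
  congr (_ `^ _)%E; rewrite -sqE //; apply: eq_integral => x _ /=.
  by rewrite powR_mulrn // real_normK ?num_real.
by rewrite poweR_EFin powR12_sqrt // sq_ge0.
Qed.

Lemma cvg_L2_norm_sq {U : Type} (F : set_system U) (f : U -> R -> R) :
  Filter F -> (\forall i \near F, L2 (f i)) ->
  (L2_norm (f i) @[i --> F] --> 0%E) -> sq (f i) @[i --> F] --> 0.
Proof.
move=> FF Lf /fine_cvg cf.
have cs : Num.sqrt (sq (f i)) @[i --> F] --> 0.
  apply: cvg_trans cf; apply: near_eq_cvg.
  by apply: filterS Lf => i /L2_normE /= ->.
have -> : 0 = 0 * 0 :> R by rewrite mulr0.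
apply: cvg_trans (cvgM cs cs); apply: near_eq_cvg.
by near=> i; rewrite /= -expr2 sqr_sqrtr // sq_ge0.
Unshelve. all: by end_near. Qed.

(** Write U(t + h) = U t + h (v + r h) with r h -> 0 in L^2. The quotient of the squared norms is
    then 2 <U t, v> + 2 <U t, r h> + h |v + r h|^2; Cauchy-Schwarz kills the second term, and the
    third is h times a bounded quantity. *)
Lemma sq_derive (U : R -> R -> R) v t :
  (\forall s \near t, L2 (U s)) -> L2 v ->
  sq (fun x => h^-1 * (U (t + h) x - U t x) - v x) @[h --> 0^'] --> 0 ->
  is_derive t 1 (fun s => sq (U s)) (2 * ip (U t) v).
Proof.
move=> LU Lv cU; have LUt : L2 (U t) := nbhs_singleton LU.
pose r h x := h^-1 * (U (t + h) x - U t x) - v x.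
have LUh : \forall h \near 0^', L2 (U (t + h)).
  have : (t + h) @[h --> 0] --> t.
    by rewrite -[X in _ --> X]addr0; apply: cvgD; [exact: cvg_cst|exact: cvg_id].
  by move=> /(_ _ LU); exact: nbhs_dnbhs.
have Lr : \forall h \near 0^', L2 (r h).
  by apply: filterS LUh => h LUh; exact/L2B/Lv/L2Z/L2B.
suff H : h^-1 *: (sq (U (h *: 1 + t)) - sq (U t)) @[h --> 0^']
    --> 2 * ip (U t) v.
  split; first by apply/cvg_ex; exists (2 * ip (U t) v).
  by apply/cvg_lim.
have cip : ip (U t) (r h) @[h --> 0^'] --> 0.
  apply/cvgr0Pnorm_lt => e e0.
  have /cvgr0Pnorm_lt := cU.
  (* Adding 1 keeps the denominator positive when U t = 0. *)
  move=> /(_ (e ^+ 2 / (sq (U t) + 1))).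
  have s1 : 0 < sq (U t) + 1 by rewrite ltr_wpDl // sq_ge0.
  move=> /(_ ltac:(by rewrite divr_gt0 // exprn_gt0)).
  apply: filterS2 Lr => h Lrh; rewrite ger0_norm ?sq_ge0 // ltr_pdivlMr // => hr.
  rewrite -(@ltr_pXn2r _ 2) ?nnegrE // ?ltW // real_normK ?num_real //.
  apply: le_lt_trans (ip_CS LUt Lrh) _; apply: le_lt_trans hr.
  by rewrite mulrC ler_wpM2l ?sq_ge0 // lerDl.
have cq : h * sq (fun x => v x + r h x) @[h --> 0^'] --> 0.
  have c1 : `|h| * (2 * sq v + 2 * sq (r h)) @[h --> 0^'] --> 0 * (2 * sq v + 2 * 0).
    apply: cvgM.
      rewrite -[X in _ --> X](@normr0 _ R); apply: cvg_norm.
      exact: nbhs_dnbhs.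
    by apply: cvgD; [exact: cvg_cst|apply: cvgM => //; exact: cvg_cst].
  rewrite mul0r in c1; apply/norm_cvg0P; apply: (squeeze_cvgr _ (cvg_cst 0) c1).
  apply: filterS Lr => h Lrh; rewrite normr_ge0 /= normrM ler_wpM2l //.
  by rewrite ger0_norm ?sq_ge0 // sqD_le.
have : 2 * ip (U t) v + 2 * ip (U t) (r h) + h * sq (fun x => v x + r h x)
    @[h --> 0^'] --> 2 * ip (U t) v + 2 * 0 + 0.
  by apply: cvgD => //; apply: cvgD; [exact: cvg_cst|apply: cvgM => //; exact: cvg_cst].
rewrite mulr0 !addr0; apply: cvg_trans; apply: near_eq_cvg.
have n0 : \forall h \near 0^', h != 0 :> R by exact: nbhs_dnbhs_neq.
near=> h; have h0 : h != 0 by near: h.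
have Lrh : L2 (r h) by near: h.
have -> : U (h *: 1 + t) = (fun x => U t x + h * (v x + r h x)).
  apply/funext => x; rewrite /r [_ *: _]mulr1 addrC; by field.
have Lvr : L2 (fun x => v x + r h x) by exact: L2D.
rewrite (sqD LUt (L2Z h Lvr)) (sqZ h Lvr) (ipZr h LUt Lvr) (ipDr LUt Lv Lrh).
rewrite /GRing.scale /=; by field.
Unshelve. all: by end_near. Qed.

End SquareIntegrable.

(** * Primitives of locally integrable functions *)

Section Primitives.
Context {R : realType}.
Notation mu := (@lebesgue_measure R).
Implicit Types (f g : R -> R) (h x y z A B C M N : R).

Definition primitive f g : Prop :=
  forall x y, x <= y -> f y - f x = \int[mu]_(z in `[x, y]) g z.

(** The bound on g is required at every point, not just almost everywhere, so that products, shifts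
    and difference quotients can be estimated pointwise. *)
Record bounded_primitive M f g : Prop := {
  bprim_measurable : measurable_fun setT g;
  bprim_bound : forall x, `|g x| <= M;
  bprim_primitive : primitive f g }.

Definition diff_quot h f x : R := h^-1 * (f (x + h) - f x).

Lemma Rintegral_itv_cst x y c : x <= y ->
  \int[mu]_(z in `[x, y]) c = c * (y - x).
Proof.
move=> xy; rewrite Rintegral_cst //= lebesgue_measure_itv /= lte_fin.
by move: xy; rewrite le_eqVlt => /predU1P[->|->]; rewrite ?ltxx ?subrr.
Qed.

Lemma itv_fin_measure x y : (mu `[x, y] < +oo)%E.
Proof. by rewrite lebesgue_measure_itv /=; case: ifP => // _; exact: ltry. Qed.

Lemma integrable_itv_cst x y c :
  mu.-integrable `[x, y] (EFin \o (fun=> c)).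
Proof.
apply: measurable_bounded_integrable => //.
  exact: itv_fin_measure.
by exists `|c|; split => // r cr z _ /=; exact: ltW.
Qed.

Lemma integrable_itvZ x y c f : mu.-integrable `[x, y] (EFin \o f) ->
  mu.-integrable `[x, y] (EFin \o (fun z => c * f z)).
Proof. exact: integrableZl. Qed.

Lemma integrable_itv_bounded M f x y : measurable_fun `[x, y] f ->
  (forall z, z \in `[x, y] -> `|f z| <= M) ->
  mu.-integrable `[x, y] (EFin \o f).
Proof.
move=> mf fM; apply: measurable_bounded_integrable => //.
  exact: itv_fin_measure.
exists M; split; first exact: num_real.
by move=> r Mr z xyz /=; apply: le_trans (fM z xyz) (ltW Mr).
Qed.

Lemma integrable_itv_locally f x y : locally_integrable setT f ->
  mu.-integrable `[x, y] (EFin \o f).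
Proof.
move=> [mf _ fi]; apply/integrableP; split.
  by apply/measurable_EFinP; exact: measurable_funTS.
by apply: fi => //; exact: segment_compact.
Qed.

Lemma Rintegral_itv_split f x y z : x <= y -> y <= z ->
  mu.-integrable `[x, z] (EFin \o f) ->
  \int[mu]_(t in `[x, z]) f t =
  \int[mu]_(t in `[x, y]) f t + \int[mu]_(t in `[y, z]) f t.
Proof.
move=> xy yz fi.
rewrite -(Rintegral_itv_obnd_cbnd (r := y)); last first.
  by apply: integrableS fi => //; apply: subset_itvr; rewrite bnd_simp.
by rewrite -(Rintegral_itvB (x := y) fi) ?bnd_simp // addrC subrK.
Qed.

Lemma normr_Rintegral_itv_le M f x y : x <= y -> measurable_fun `[x, y] f ->
  (forall z, z \in `[x, y] -> `|f z| <= M) ->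
  `|\int[mu]_(z in `[x, y]) f z| <= M * (y - x).
Proof.
move=> xy mf fM; have fi := integrable_itv_bounded mf fM.
rewrite -Rintegral_itv_cst //; apply: le_trans (le_normr_Rintegral _ fi) _ => //.
apply: le_Rintegral => //.
- exact: integrable_norm.
- exact: integrable_itv_cst.
Qed.

Lemma bprim_integrable M f g x y : bounded_primitive M f g ->
  mu.-integrable `[x, y] (EFin \o g).
Proof.
move=> [mg gM _]; apply: (@integrable_itv_bounded M) => //.
exact: measurable_funTS.
Qed.

Lemma bprim_lipschitz_le M f g x y : bounded_primitive M f g -> x <= y ->
  `|f y - f x| <= M * (y - x).
Proof.
move=> [mg gM fg] xy; rewrite fg //; apply: normr_Rintegral_itv_le => //.
exact: measurable_funTS.
Qed.

Lemma bprim_lipschitz M f g x y : bounded_primitive M f g ->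
  `|f y - f x| <= M * `|y - x|.
Proof.
move=> fg; wlog xy : x y / x <= y => [H|]; last first.
  by rewrite [`|y - x|]ger0_norm ?subr_ge0 //; exact: bprim_lipschitz_le fg xy.
have [/H//|yx] := leP x y.
by rewrite distrC [`|y - x|]distrC; apply: H; exact: ltW.
Qed.

Lemma bprim_ge0 M f g : bounded_primitive M f g -> 0 <= M.
Proof. by move=> [_ gM _]; exact: le_trans (gM 0). Qed.

Lemma lipschitz_continuous M f : (forall x y, `|f y - f x| <= M * `|y - x|) ->
  continuous f.
Proof.
move=> fM x; apply/cvgrPdist_lt => e e0.
have M0 : 0 < `|M| + 1 by rewrite ltr_wpDl.
near=> y; apply: (@le_lt_trans _ _ ((`|M| + 1) * `|x - y|)).
  apply: le_trans (fM y x) _; rewrite ler_wpM2r // ler_wpDr //.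
  exact: ler_norm.
rewrite mulrC -ltr_pdivlMr //; near: y.
by apply: cvgr_dist_lt => //; rewrite divr_gt0.
Unshelve. all: by end_near. Qed.

Lemma bprim_continuous M f g : bounded_primitive M f g -> continuous f.
Proof.
by move=> fg; apply: (@lipschitz_continuous M) => x y; exact: bprim_lipschitz fg.
Qed.

Lemma bprim_measurable_fun M f g : bounded_primitive M f g ->
  measurable_fun setT f.
Proof.
by move=> /bprim_continuous cf; exact: continuous_measurable_fun.
Qed.

(* Subdividing [x, y] into n equal parts bounds the increment by C (y-x)^2/n. *)
Lemma quadratic_increments_cst C (f : R -> R) x y : x <= y ->
  (forall s t, x <= s -> s <= t -> t <= y -> `|f t - f s| <= C * (t - s) ^+ 2) ->
  f y = f x.
Proof.
move=> xy fC; apply/eqP; rewrite -subr_eq0 -normr_le0.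
apply/ler_addgt0Pl => e e0; rewrite addr0.
pose n := (Num.truncn (C * (y - x) ^+ 2 / e)).+1.
have n0 : 0 < n%:R :> R by rewrite ltr0n.
have Cn : C * (y - x) ^+ 2 / n%:R <= e.
  by rewrite ler_pdivrMr // [e * _]mulrC -ler_pdivrMr // ltW // truncnS_gt.
apply: le_trans Cn.
pose d := (y - x) / n%:R; pose p k := x + k%:R * d.
have d0 : 0 <= d by rewrite divr_ge0 ?subr_ge0 // ltW.
have pn : p n = y by rewrite /p /d mulrC divfK ?gt_eqF // addrC subrK.
have H k : (k <= n)%N -> `|f (p k) - f x| <= k%:R * (C * d ^+ 2).
  elim: k => [_|k IH kn]; first by rewrite /p !mul0r addr0 subrr normr0.
  have /IH {}IH : (k <= n)%N by exact: ltnW.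
  have -> : f (p k.+1) - f x = (f (p k.+1) - f (p k)) + (f (p k) - f x).
    by ring.
  rewrite -[k.+1]addn1 natrD mulrDl mul1r addrC [leRHS]addrC.
  apply: le_trans (ler_normD _ _) _; rewrite addrC lerD //.
  have -> : d = p (k + 1)%N - p k by rewrite /p natrD; ring.
  apply: fC.
  - by rewrite /p lerDl mulr_ge0.
  - by rewrite /p lerD2l ler_wpM2r // ler_nat addn1.
  - by rewrite -pn /p lerD2l ler_wpM2r // ler_nat addn1.
have := H n (leqnn n); rewrite pn.
suff -> : n%:R * (C * d ^+ 2) = C * (y - x) ^+ 2 / n%:R by [].
by rewrite /d; field; rewrite gt_eqF.
Qed.

Lemma bprimM M N A B f g f2 g2 :
  bounded_primitive M f g -> bounded_primitive N f2 g2 ->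
  (forall x, `|f x| <= A) -> (forall x, `|f2 x| <= B) ->
  bounded_primitive (A * N + B * M) (fun x => f x * f2 x)
    (fun x => f x * g2 x + f2 x * g x).
Proof.
move=> fg fg2 fA fB.
have mf := bprim_measurable_fun fg; have mf2 := bprim_measurable_fun fg2.
have [mg gM _] := fg; have [mg2 gN _] := fg2.
have mG : measurable_fun setT (fun x => f x * g2 x + f2 x * g x).
  by apply: measurable_funD; exact: measurable_funM.
have GM x : `|f x * g2 x + f2 x * g x| <= A * N + B * M.
  by apply: le_trans (ler_normD _ _) _; rewrite !normrM lerD // ler_pM.
have Gi x y : mu.-integrable `[x, y] (EFin \o (fun x => f x * g2 x + f2 x * g x)).
  apply: (@integrable_itv_bounded (A * N + B * M)) => //.
  exact: measurable_funTS.
split => // x y xy; apply/eqP; rewrite -subr_eq0; apply/eqP.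
pose H t := f t * f2 t - f x * f2 x -
  \int[mu]_(z in `[x, t]) (f z * g2 z + f2 z * g z).
have Hx : H x = 0 by rewrite /H subrr sub0r set_itv1 Rintegral_set1 oppr0.
rewrite -/(H y) -Hx.
apply: (@quadratic_increments_cst (2 * M * N)) => // s t xs st ty.
have -> : H t - H s = \int[mu]_(z in `[s, t])
   ((f t - f z) * g2 z + (f2 s - f2 z) * g z).
  have -> : \int[mu]_(z in `[s, t]) ((f t - f z) * g2 z + (f2 s - f2 z) * g z) =
     f t * (f2 t - f2 s) + f2 s * (f t - f s) -
     \int[mu]_(z in `[s, t]) (f z * g2 z + f2 z * g z).
    rewrite (bprim_primitive fg st) (bprim_primitive fg2 st).
    have i1 := bprim_integrable s t fg; have i2 := bprim_integrable s t fg2.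
    have j1 := integrable_itvZ (f2 s) i1.
    have j2 := integrable_itvZ (f t) i2.
    rewrite -!RintegralZl // -RintegralD // -RintegralB //; last first.
      exact: (integrableD _ j2 j1).
    by apply: eq_Rintegral => z _; ring.
  by rewrite /H (@Rintegral_itv_split _ x s t) //; ring.
rewrite expr2 mulrA; apply: normr_Rintegral_itv_le => //.
  apply: measurable_funTS; apply: measurable_funD; apply: measurable_funM => //;
  exact: measurable_funB.
move=> z; rewrite in_itv /= => /andP[sz zt].
have M0 := bprim_ge0 fg; have N0 := bprim_ge0 fg2.
apply: le_trans (ler_normD _ _) _; rewrite !normrM.
have b1 : `|f t - f z| <= M * (t - s).
  apply: le_trans (bprim_lipschitz_le fg zt) _.
  by rewrite ler_wpM2l // lerD2l lerN2.
have b2 : `|f2 s - f2 z| <= N * (t - s).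
  rewrite distrC; apply: le_trans (bprim_lipschitz_le fg2 sz) _.
  by rewrite ler_wpM2l // lerD2r.
have -> : 2 * M * N * (t - s) = M * (t - s) * N + N * (t - s) * M by ring.
by rewrite lerD // ler_pM.
Qed.

(** This turns the increment f (x + h) - f x of a primitive into a convolution, to which Fubini
    applies. *)
Lemma convolution_indic h g x : 0 <= h ->
  convolution (\1_(`[- h, 0]%classic)) g x = \int[mu]_(y in `[x, x + h]) g y.
Proof.
move=> h0; rewrite [RHS]Rintegral_mkcond /convolution.
have E (y : R) : (x - y \in `[- h, 0]%classic) = (y \in `[x, x + h]%classic).
  by apply/idP/idP => /set_mem /=; rewrite in_itv /= => /andP[? ?];
    apply/mem_set; rewrite /= in_itv /=; apply/andP; split; lra.
apply: eq_Rintegral => y _; rewrite patchE indicE E.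
by case: ifP; rewrite ?mul1r ?mul0r.
Qed.

Lemma integ_indic_itv x y : integ (\1_(`[x, y]%classic) : R -> R).
Proof. exact: integrable_indic_itv. Qed.

Lemma Rintegral_indic_itv x y : x <= y ->
  \int[mu]_z (\1_(`[x, y]%classic) z) = y - x :> R.
Proof.
move=> xy; transitivity (\int[mu]_(z in `[x, y]) (1 : R)).
  rewrite [RHS]Rintegral_mkcond; apply: eq_Rintegral => z _.
  by rewrite patchE indicE; case: ifP.
by rewrite Rintegral_itv_cst // mul1r.
Qed.

(** No decay at infinity is discussed: the integral of f (x + 1) - f x is 0 by translation
    invariance, and by Fubini it equals the integral of g, the indicator of [-1, 0] having mass
    1. *)
Lemma Rintegral_bprim M f g : bounded_primitive M f g -> integ f -> integ g ->
  \int[mu]_x g x = 0.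
Proof.
move=> fg fi gi.
have : \int[mu]_x (f (x + 1) - f x) = 0.
  rewrite RintegralB //; last exact: integrable_shift.
  by rewrite Rintegral_shift // subrr.
have E x : f (x + 1) - f x = convolution (\1_(`[- 1, 0]%classic)) g x.
  by rewrite convolution_indic // (bprim_primitive fg) // lerDl.
under eq_Rintegral do rewrite E.
rewrite Rintegral_convolution //; last exact: integ_indic_itv.
by rewrite Rintegral_indic_itv ?lerN10 // opprK add0r mul1r.
Qed.

(** The difference quotient is the mean of g over [x, x + 1/(n+1)], so this is Lebesgue
    differentiation along sets that shrink nicely to x. *)
Lemma diff_quot_ae_cvg f g : locally_integrable setT g -> primitive f g ->
  {ae mu, forall x, diff_quot n.+1%:R^-1 f x @[n --> \oo] --> g x}.
Proof.
move=> lg fg; have := lebesgue_differentiation lg.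
pose E x (n : nat) : set R := `[x, x + n.+1%:R^-1]%classic.
have hE x : nicely_shrinking x (E x).
  split; first by move=> n; exact: measurable_itv.
  have r0 n : (0 : R) < 2 * n.+1%:R^-1 by rewrite mulr_gt0 // invr_gt0 ltr0n.
  (* With r = 1/(n+1), the open ball of radius 2 r contains [x, x + r] and has measure 4 r, four
     times that of the interval. *)
  exists (4, fun n => PosNum (r0 n)); split => //=.
  - rewrite -[X in _ --> X](mulr0 2); apply: cvgM; first exact: cvg_cst.
    exact: cvg_harmonic.
  - move=> n z; rewrite /E /= in_itv /= ball_itv /= in_itv /=.
    move: (r0 n); set r := n.+1%:R^-1 => ? /andP[? ?].
    by apply/andP; split; lra.
  - move=> n; rewrite lebesgue_measure_ball; last exact: ltW.
    rewrite /E lebesgue_measure_itv /=.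
    rewrite lte_fin ltrDl invr_gt0 ltr0n /= -EFinB -EFinM lee_fin.
    rewrite -mulr_natl; move: (r0 n); set r := n.+1%:R^-1 => ?; lra.
apply: filterS => x gx.
have := nice_lebesgue_differentiation hE lg gx.
move=> /fine_cvg; apply: cvg_trans; apply: near_eq_cvg; apply: nearW => n.
have xn : x <= x + n.+1%:R^-1 by rewrite lerDl invr_ge0.
rewrite /diff_quot fg // /E /= lebesgue_measure_itv /= lte_fin ltrDl invr_gt0 ltr0n /=.
have -> : ((x + n.+1%:R^-1)%:E - x%:E = (n.+1%:R^-1)%:E :> \bar R)%E.
  by rewrite -EFinB; congr (_%:E); ring.
rewrite inver gt_eqF ?invr_gt0 //.
rewrite -[X in (_ * X)%E]fineK; last first.
  by apply: integrable_fin_num => //; exact: integrable_itv_locally.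
by [].
Qed.

Lemma measurable_diff_quot h f : measurable_fun setT f ->
  measurable_fun setT (diff_quot h f).
Proof.
move=> mf; apply: measurable_funM => //; apply: measurable_funB => //.
exact: (measurableT_comp mf (measurable_shift h)).
Qed.

Lemma L2_diff_quot h f : L2 f -> L2 (diff_quot h f).
Proof. by move=> Lf; apply/L2Z/L2B => //; exact: L2_shift. Qed.

(** Jensen: the difference quotient is the mean of g over [x, x + h], so its square is at most the
    mean of g^2. Integrating in x, Fubini gives back the integral of g^2. *)
Lemma sq_diff_quot_le M f g h : 0 < h -> bounded_primitive M f g ->
  L2 f -> L2 g -> sq (diff_quot h f) <= sq g.
Proof.
move=> h0 fg Lf Lg; have h0' := ltW h0.
have ii := @integ_indic_itv (- h) 0.
have ic := Rintegral_convolution ii Lg.2.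
rewrite Rintegral_indic_itv ?oppr_le0 // sub0r opprK in ic.
have -> : sq g = h^-1 * \int[mu]_x
    convolution (\1_(`[- h, 0]%classic)) (fun x => g x ^+ 2) x.
  by rewrite ic mulKf ?gt_eqF.
have icv : integ (convolution (\1_(`[- h, 0]%classic)) (fun x => g x ^+ 2)).
  exact: integrable_convolution ii Lg.2.
rewrite -RintegralZl //; apply: le_Rintegral => //.
- exact: (L2_diff_quot h Lf).2.
- exact: integZ.
move=> x _; rewrite convolution_indic //.
have xh : x <= x + h by rewrite lerDl.
have mg := L2_measurable Lg.
have gi := bprim_integrable x (x + h) fg.
have g2i : mu.-integrable `[x, x + h] (EFin \o (fun z => g z ^+ 2)).
  by apply: integrableS Lg.2.
set w := diff_quot h f x.
have wE : \int[mu]_(z in `[x, x + h]) g z = h * w.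
  by rewrite -(bprim_primitive fg xh) /w /diff_quot mulVKf ?gt_eqF.
(* Jensen's inequality in the form that the variance of g over the interval is nonnegative. *)
have : 0 <= \int[mu]_(z in `[x, x + h]) (g z - w) ^+ 2.
  by apply: Rintegral_ge0 => z _; exact: sqr_ge0.
have j1 := integrable_itvZ (2 * w) gi.
have j2 := integrable_itv_cst x (x + h) (w ^+ 2).
have -> : \int[mu]_(z in `[x, x + h]) (g z - w) ^+ 2 =
   \int[mu]_(z in `[x, x + h]) (g z ^+ 2) - 2 * w * (h * w) + w ^+ 2 * h.
  rewrite -wE -RintegralZl // -RintegralB //.
  have -> : w ^+ 2 * h = \int[mu]_(z in `[x, x + h]) (w ^+ 2).
    by rewrite Rintegral_itv_cst //; congr (_ * _); ring.
  rewrite -RintegralD //; last exact: (integrableB _ g2i j1).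
  by apply: eq_Rintegral => z _; ring.
by move=> H; rewrite -(ler_pM2l h0) mulVKf ?gt_eqF //; lra.
Qed.

(** Fatou's lemma along h = 1/(n+1), where the difference quotients converge to g almost
    everywhere. *)
Lemma sq_le_diff_quot M B f g : bounded_primitive M f g -> L2 f -> L2 g ->
  (forall n : nat, sq (diff_quot n.+1%:R^-1 f) <= B) -> sq g <= B.
Proof.
move=> fg Lf Lg fB.
have lg : locally_integrable setT g.
  split; [exact: bprim_measurable fg|exact: openT|move=> K _ cK].
  have mK : measurable K by apply: compact_measurable.
  have : mu.-integrable K (EFin \o g).
    apply: measurable_bounded_integrable => //.
    - exact: compact_finite_measure.
    - by apply: measurable_funTS; exact: bprim_measurable fg.
    - exists M; split; first exact: num_real.
      by move=> r Mr z _ /=; exact: le_trans (bprim_bound fg z) (ltW Mr).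
  by case/integrableP.
have cv := diff_quot_ae_cvg lg (bprim_primitive fg).
pose F n x := (diff_quot n.+1%:R^-1 f x ^+ 2)%:E.
have mF n : measurable_fun setT (F n).
  apply/measurable_EFinP; apply: measurable_funX.
  exact: measurable_diff_quot (L2_measurable Lf).
have F0 n x : setT x -> (0 <= F n x)%E by rewrite lee_fin sqr_ge0.
have fat := fatou mu measurableT mF F0.
have mg := L2_measurable Lg.
have e1 : (\int[mu]_x limn_einf (F^~ x) = (sq g)%:E)%E.
  rewrite -sqE //. apply: ae_eq_integral => //.
  - apply: (measurableT_comp (f := -%E)) => //.
    apply: (measurable_fun_limn_esup (f := fun n x => (- F n x)%E)) => n.
    exact: (measurableT_comp (f := -%E)).
  - exact/measurable_EFinP/measurable_funX.
  apply: filterS cv => x cx _.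
  have cF : F n x @[n --> \oo] --> (g x ^+ 2)%:E.
    by apply: cvg_EFin; [exact: nearW|apply: cvgM].
  by rewrite (cvg_limn_einf_sup cF).1.
rewrite -lee_fin -e1; apply: le_trans fat _.
rewrite limn_einf_lim; apply: lime_le; first exact: is_cvg_einfs.
apply: nearW => n; apply: (@le_trans _ _ (\int[mu]_x F n x)%E).
  by apply: ereal_inf_lbound; exists n => //=.
rewrite /F sqE ?lee_fin //; exact: L2_diff_quot.
Qed.

(** For a fixed h the difference quotient is a bounded operator on L^2. The bound degenerates as h
    -> 0 and serves only to differentiate in time under a fixed h. *)
Lemma sq_diff_quot_le_inv h (f : R -> R) : L2 f ->
  sq (diff_quot h f) <= h^-1 ^+ 2 * 4 * sq f.
Proof.
move=> Lf; have Lfh := L2_shift h Lf.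
have -> : diff_quot h f = (fun x => h^-1 * (f (x + h) + -1 * f x)).
  by apply/funext => x; rewrite /diff_quot mulN1r.
rewrite sqZ; last by apply: L2D => //; exact: L2Z.
rewrite -mulrA; apply: ler_wpM2l; first exact: sqr_ge0.
apply: le_trans (sqD_le Lfh (L2Z (-1) Lf)) _.
by rewrite sqZ // sq_shift //; lra.
Qed.

Lemma lipschitz_of_derive (phi phi' : R -> R) (a r K : R) : 0 <= K ->
  (forall s, `|s - a| < r -> is_derive s 1 phi (phi' s)) ->
  (forall s, `|s - a| < r -> `|phi' s| <= K) ->
  forall s, `|s - a| < r -> `|phi s - phi a| <= K * `|s - a|.
Proof.
move=> K0 dphi bphi s sr.
have r0 : 0 < r by exact: le_lt_trans sr.
have H x y : x < y -> (forall z, x <= z <= y -> `|z - a| < r) ->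
    `|phi y - phi x| <= K * (y - x).
  move=> xy xyr.
  have dxy z : z \in `]x, y[ -> is_derive z 1 phi (phi' z).
    by rewrite in_itv /= => /andP[? ?]; apply: dphi; apply: xyr; rewrite !ltW.
  have cxy : {within `[x, y], continuous phi}.
    apply: derivable_within_continuous => z; rewrite in_itv /= => zxy.
    by have [] := dphi z (xyr z zxy).
  have [c cI ->] := MVT xy dxy cxy.
  rewrite normrM [`|y - x|]gtr0_norm ?subr_gt0 //.
  apply: ler_wpM2r; first by rewrite subr_ge0 ltW.
  apply: bphi; apply: xyr; move: cI; rewrite in_itv /= => /andP[? ?].
  by rewrite !ltW.
have [sa|sa|->] := ltgtP s a; last by rewrite !subrr normr0 mulr0.
- rewrite distrC [`|s - a|]distrC [`|a - s|]gtr0_norm ?subr_gt0 //.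
  apply: H => // z /andP[sz za]; move: sr; rewrite !ltr_norml => /andP[? ?].
  by apply/andP; split; lra.
- rewrite [`|s - a|]gtr0_norm ?subr_gt0 //.
  apply: H => // z /andP[sz za]; move: sr; rewrite !ltr_norml => /andP[? ?].
  by apply/andP; split; lra.
Qed.

End Primitives.

(** * Energy estimate for difference quotients *)

Section Schur.
Context {R : realType}.
Notation mu := (@lebesgue_measure R).
Implicit Types (f g k : R -> R) (h x y : R).

Lemma integ_reflect k x : integ k -> integ (fun y => k (x - y)).
Proof.
move=> ik; have mk := integ_measurable ik; apply/integrableP; split.
  by apply/measurable_EFinP; exact: (measurableT_comp mk (measurable_reflect x)).
rewrite (ge0_integral_reflect (f := fun y => `|(k y)%:E|%E)) //.
  by case/integrableP: ik.
by apply: measurableT_comp => //; exact/measurable_EFinP.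
Qed.

Lemma Rintegral_norm_reflect k x : integ k ->
  \int[mu]_y `|k (x - y)| = \int[mu]_y `|k y|.
Proof.
move=> ik; rewrite /Rintegral; congr fine.
apply: (ge0_integral_reflect (f := fun y => `|k y|%:E)) => //.
by apply/measurable_EFinP/measurableT_comp => //; exact: integ_measurable.
Qed.

Lemma integ_conv_bounded B k g x : measurable_fun setT k ->
  (forall y, `|k y| <= B) -> integ g -> integ (fun y => k (x - y) * g y).
Proof.
move=> mk kB ig; apply: (@integ_boundM _ B) => //.
exact: (measurableT_comp mk (measurable_reflect x)).
Qed.

(** The inequality 2 |f(x) g(y)| <= f(x)^2 + g(y)^2 is integrated against |k(x - y)| in y. The
    pointwise bound B on k makes the convolution integral converge at every x, not just almost
    everywhere. *)
Lemma schur_pointwise B k f g x : integ k -> (forall y, `|k y| <= B) ->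
  integ g -> L2 g ->
  `|f x * convolution k g x| <= 2^-1 *
    ((\int[mu]_y `|k y|) * f x ^+ 2 +
     convolution (fun y => `|k y|) (fun y => g y ^+ 2) x).
Proof.
move=> ik kB ig Lg; have mk := integ_measurable ik.
have mn : measurable_fun setT (fun y => `|k y|) by exact: measurableT_comp.
have ic := integ_conv_bounded x mk kB ig.
have ic2 : integ (fun y => `|k (x - y)| * g y ^+ 2).
  apply: (@integ_conv_bounded B (fun y => `|k y|) (fun y => g y ^+ 2)) Lg.2 => //.
  by move=> y; rewrite normr_id.
have ir := integ_norm (integ_reflect x ik).
rewrite /convolution -(Rintegral_norm_reflect x ik) -RintegralZr //.
rewrite -RintegralD //; last exact: (integrableZr measurableT (f x ^+ 2) ir).
rewrite -RintegralZl //.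
have iD : integ (fun y => `|k (x - y)| * f x ^+ 2 + `|k (x - y)| * g y ^+ 2).
  apply: (integD (f := fun y => `|k (x - y)| * f x ^+ 2)) => //.
  exact: (integrableZr measurableT (f x ^+ 2) ir).
rewrite -RintegralZl //; apply: le_normr_Rint.
- exact: integZ.
- exact: integZ.
move=> y; rewrite mulrCA normrM -mulrDr mulrCA ler_wpM2l // normrM.
have := sqr_ge0 (`|f x| - `|g y|); rewrite -[f x ^+ 2]real_normK ?num_real //.
rewrite -[g y ^+ 2]real_normK ?num_real //; nra.
Qed.

Lemma schur_test B k f g : integ k -> (forall y, `|k y| <= B) ->
  L2 f -> integ g -> L2 g -> integ (fun x => f x * convolution k g x) /\
  `|ip f (convolution k g)| <= 2^-1 * (\int[mu]_y `|k y|) * (sq f + sq g).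
Proof.
move=> ik kB Lf ig Lg.
pose D x := 2^-1 * ((\int[mu]_y `|k y|) * f x ^+ 2 +
     convolution (fun y => `|k y|) (fun y => g y ^+ 2) x).
have icv : integ (convolution (fun y => `|k y|) (fun y => g y ^+ 2)).
  by apply: integrable_convolution Lg.2; exact: integ_norm.
have iD : integ D by apply/integZ/integD => //; exact: integZ Lf.2.
have ii : integ (fun x => f x * convolution k g x).
  apply: (@integ_le _ D) => //; last by move=> x; exact: schur_pointwise kB ig Lg.
  by apply: measurable_funM; [exact: Lf.1|exact: measurable_convolution].
split=> //; apply: (@le_trans _ _ (\int[mu]_x D x)).
  by apply: le_normr_Rint => // x; exact: schur_pointwise kB ig Lg.
rewrite /D RintegralZl //; last by apply: integD => //; exact: integZ Lf.2.
rewrite RintegralD //; last exact: integZ Lf.2.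
rewrite RintegralZl //; last exact: Lf.2.
rewrite Rintegral_convolution //; [|exact: integ_norm|exact: Lg.2].
by rewrite -mulrA -mulrDr.
Qed.

Lemma diff_quot_convolution B k g h x : measurable_fun setT k ->
  (forall y, `|k y| <= B) -> integ g ->
  diff_quot h (convolution k g) x = convolution (diff_quot h k) g x.
Proof.
move=> mk kB ig; rewrite /diff_quot /convolution.
have ic z := integ_conv_bounded z mk kB ig.
rewrite -RintegralB //; [|exact: ic|exact: ic].
rewrite -RintegralZl //; last exact: integB.
apply: eq_Rintegral => y _; rewrite -mulrA mulrBl.
by congr (_ * (k _ * _ - _)); rewrite addrAC.
Qed.

End Schur.

(** * The Camassa-Holm kernel and the L^1 norm of its difference quotients *)

Section Kernel.
Context {R : realType}.
Notation mu := (@lebesgue_measure R).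
Implicit Types (h x y : R).

Let decay x : R := expR (- `|x|).

Lemma integ_expR_abs : integ decay.
Proof.
have md : measurable_fun setT decay.
  by apply: measurableT_comp => //; apply: measurable_funN; exact: normr_measurable.
have ip : integ (@exponential_pdf R 1) by exact: integrable_exponential_pdf.
(* exp (- |x|) is dominated by the exponential density of rate 1 plus its reflection. *)
apply: (integ_le md (integD ip (integ_reflect 0 ip))) => x.
rewrite ger0_norm ?expR_ge0 //; have [x0|x0] := leP 0 x.
  rewrite [exponential_pdf 1 x]exponential_pdfE // mul1r mulN1r /decay.
  by rewrite ger0_norm // lerDl exponential_pdf_ge0.
have -> : exponential_pdf 1 (0 - x) = decay x.
  rewrite exponential_pdfE ?sub0r ?oppr_ge0 ?ltW // mul1r mulN1r /decay.
  by rewrite ltr0_norm.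
by rewrite lerDr exponential_pdf_ge0.
Qed.

Lemma CH_kernel_le x : `|CH_kernel x| <= 2^-1 * decay x.
Proof.
rewrite /CH_kernel !normrM normrN [`|2^-1|]ger0_norm ?invr_ge0 //.
rewrite [`|expR _|]ger0_norm ?expR_ge0 // -mulrA ler_wpM2l ?invr_ge0 //.
by rewrite ler_piMl ?expR_ge0 // normr_sg; case: (x != 0).
Qed.

Lemma CH_kernel_bounded x : `|CH_kernel x| <= 1.
Proof.
apply: le_trans (CH_kernel_le x) _; rewrite mulrC ler_pdivrMr //.
rewrite mul1r (@le_trans _ _ 1) ?ler1n // -expR0 ler_expR.
by rewrite oppr_le0.
Qed.

Lemma measurable_sgr : measurable_fun setT (@Num.sg R).
Proof.
have -> : @Num.sg R = (fun x => \1_(`]0, +oo[%classic) x - \1_(`]-oo, 0[%classic) x).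
  apply/funext => x; rewrite !indicE !mem_setE !in_itv /= andbT.
  have [x0|x0|->] := ltgtP x 0.
  - by rewrite ltr0_sg // sub0r.
  - by rewrite gtr0_sg // subr0.
  - by rewrite sgr0 subrr.
apply: measurable_funB; exact: measurable_indic.
Qed.

Lemma measurable_CH_kernel : measurable_fun setT (@CH_kernel R).
Proof.
apply: measurable_funM; last first.
  by apply: measurableT_comp => //; apply: measurable_funN; exact: normr_measurable.
by apply: measurable_funM => //; exact: measurable_sgr.
Qed.

Lemma integ_CH_kernel : integ (@CH_kernel R).
Proof.
apply: (@integ_le _ (fun x => 2^-1 * decay x)).
- exact: measurable_CH_kernel.
- exact/integZ/integ_expR_abs.
- exact: CH_kernel_le.
Qed.

(* The indicator covers the jump of the kernel at 0. *)
Lemma diff_quot_CH_kernel_le h x : 0 < h -> h <= 1 ->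
  `|diff_quot h CH_kernel x| <=
     expR 1 * decay x + h^-1 * \1_(`[- h, 0]%classic) x.
Proof.
move=> h0 h1; rewrite /diff_quot normrM [`|h^-1|]ger0_norm; last by rewrite invr_ge0 ltW.
rewrite mulrC ler_pdivrMr // mulrDl [h^-1 * _ * h]mulrAC mulVf ?gt_eqF // mul1r.
have e1 : 1 <= expR 1 :> R by rewrite -[leLHS]expR0 ler_expR.
have d0 : 0 <= decay x by exact: expR_ge0.
rewrite indicE; case: (boolP (x \in _)) => [_|].
  rewrite /=; have b1 := CH_kernel_le (x + h); have b2 := CH_kernel_le x.
  have dle y : decay y <= 1 by rewrite /decay -[leRHS]expR0 ler_expR oppr_le0.
  have := dle x; have := dle (x + h).
  have : 0 <= expR 1 * decay x * h by rewrite !mulr_ge0 ?expR_ge0 // ltW.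
  have := ler_normB (CH_kernel (x + h)) (CH_kernel x).
  by rewrite /= mulr1n; lra.
rewrite notin_setE /= in_itv /= => /negP; rewrite negb_and -!ltNge mulr0n addr0.
case/orP => xh.
  have x0 : x < 0 by rewrite (lt_trans xh) // oppr_lt0.
  have xh0 : x + h < 0 by rewrite -[ltRHS](subrr h) addrC ltrBrDl; lra.
  rewrite /CH_kernel /decay !ltr0_sg // (ltr0_norm x0) (ltr0_norm xh0) !opprK expRD.
  have -> : - 2^-1 * -1 * (expR x * expR h) - - 2^-1 * -1 * expR x =
    2^-1 * (expR x * (expR h - 1)) by ring.
  (* Multiply 1 - h <= exp (- h) by exp h to get exp h - 1 <= h exp h, then use h <= 1. *)
  have eh : expR h - 1 <= expR 1 * h.
    have := expR_ge1Dx (- h); rewrite expRN => H.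
    have eh0 : 0 < expR h by exact: expR_gt0.
    have : 1 - h <= (expR h)^-1 by [].
    rewrite -(ler_pM2l eh0) mulfV ?gt_eqF // => H2.
    have : expR h <= expR 1 by rewrite ler_expR.
    nra.
  have eh1 : 0 <= expR h - 1 by rewrite subr_ge0 -[leLHS]expR0 ler_expR ltW.
  have ex := expR_ge0 x.
  rewrite ger0_norm; last by rewrite !mulr_ge0.
  rewrite [expR 1 * _]mulrC -mulrA; apply: (@le_trans _ _ (expR x * (expR h - 1))).
    have := mulr_ge0 ex eh1; lra.
  by rewrite ler_wpM2l.
have xh0 : 0 < x + h by rewrite addr_gt0.
rewrite /CH_kernel /decay !gtr0_sg // (gtr0_norm xh) (gtr0_norm xh0) opprD expRD.
have -> : - 2^-1 * 1 * (expR (- x) * expR (- h)) - - 2^-1 * 1 * expR (- x) =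
    2^-1 * (expR (- x) * (1 - expR (- h))) by ring.
have ex := expR_ge0 (- x).
have eh := expR_ge1Dx (- h).
have eh1 : 0 <= 1 - expR (- h) by rewrite subr_ge0 -[leRHS]expR0 ler_expR oppr_le0 ltW.
rewrite ger0_norm; last by rewrite !mulr_ge0.
rewrite [expR 1 * _]mulrC -mulrA; apply: (@le_trans _ _ (expR (- x) * (1 - expR (- h)))).
  have := mulr_ge0 ex eh1; lra.
by rewrite ler_wpM2l //; nra.
Qed.

Lemma diff_quot_CH_kernel_bounded h y : 0 < h ->
  `|diff_quot h CH_kernel y| <= h^-1 * 2.
Proof.
move=> h0; rewrite /diff_quot normrM ger0_norm; last by rewrite invr_ge0 ltW.
apply: ler_wpM2l; first by rewrite invr_ge0 ltW.
apply: le_trans (ler_normB _ _) _.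
by have := CH_kernel_bounded (y + h); have := CH_kernel_bounded y; lra.
Qed.

Lemma integ_diff_quot_CH_kernel h : integ (diff_quot h (@CH_kernel R)).
Proof.
apply/integZ/integB; last exact: integ_CH_kernel.
exact: (integrable_shift h integ_CH_kernel).
Qed.

(** Uniformity in h is the point: the jump of the kernel contributes height h^-1 over a length h,
    that is, the summand 1. *)
Lemma Rintegral_diff_quot_CH_kernel h : 0 < h -> h <= 1 ->
  \int[mu]_x `|diff_quot h CH_kernel x| <= expR 1 * (\int[mu]_x decay x) + 1.
Proof.
move=> h0 h1.
have i1 : integ (fun x => expR 1 * decay x) by exact/integZ/integ_expR_abs.
have i2 : integ (fun x => h^-1 * \1_(`[- h, 0]%classic) x).
  exact/integZ/integ_indic_itv.
apply: (@le_trans _ _ (\int[mu]_x (expR 1 * decay x + h^-1 * \1_(`[- h, 0]%classic) x))).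
  apply: le_Rintegral => //.
  - exact/integ_norm/integ_diff_quot_CH_kernel.
  - exact: integD.
  - by move=> x _; exact: diff_quot_CH_kernel_le.
rewrite RintegralD // RintegralZl //; last exact: integ_expR_abs.
rewrite RintegralZl //; last exact: integ_indic_itv.
by rewrite Rintegral_indic_itv ?oppr_le0 ?(ltW h0) // sub0r opprK mulVf ?gt_eqF.
Qed.

End Kernel.

(** * Calculus of bounded primitives and the bound on the derivative of E_h *)

Section EnergyEstimate.
Context {R : realType}.
Notation mu := (@lebesgue_measure R).
Implicit Types (f g v : R -> R) (h x y M : R).

Lemma bprim_shift M f g h : bounded_primitive M f g ->
  bounded_primitive M (fun x => f (x + h)) (fun x => g (x + h)).
Proof.
move=> [mg gM fg]; split => // [|x y xy].
  exact: (measurableT_comp mg (measurable_shift h)).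
rewrite fg ?lerD2r // [LHS]Rintegral_mkcond.
pose G := g \_ `[x + h, y + h].
have iG : integ G.
  rewrite /integ /G -restrict_EFin.
  apply/integrable_restrict => //=; rewrite setTI.
  by apply: (@integrable_itv_bounded R M) => // ; exact: measurable_funTS.
rewrite -(Rintegral_shift h iG) [RHS]Rintegral_mkcond.
apply: eq_Rintegral => z _; rewrite /G !patchE.
have -> : (z + h \in `[x + h, y + h]%classic) = (z \in `[x, y]%classic).
  by rewrite !mem_setE !in_itv /= !lerD2r.
by [].
Qed.

Lemma bprimD M N f g f2 g2 : bounded_primitive M f g ->
  bounded_primitive N f2 g2 ->
  bounded_primitive (M + N) (fun x => f x + f2 x) (fun x => g x + g2 x).
Proof.
move=> fg fg2; split.
- exact: measurable_funD (bprim_measurable fg) (bprim_measurable fg2).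
- move=> x; apply: le_trans (ler_normD _ _) _.
  by rewrite lerD ?(bprim_bound fg) ?(bprim_bound fg2).
- move=> x y xy; rewrite RintegralD //; last 2 first.
  + exact: bprim_integrable fg.
  + exact: bprim_integrable fg2.
  by rewrite -(bprim_primitive fg xy) -(bprim_primitive fg2 xy); ring.
Qed.

Lemma bprimZ c M f g : bounded_primitive M f g ->
  bounded_primitive (`|c| * M) (fun x => c * f x) (fun x => c * g x).
Proof.
move=> fg; split.
- by apply: measurable_funM => //; exact: bprim_measurable fg.
- by move=> x; rewrite normrM ler_wpM2l ?(bprim_bound fg).
- move=> x y xy; rewrite RintegralZl //; last exact: bprim_integrable fg.
  by rewrite -(bprim_primitive fg xy); ring.
Qed.

Lemma bprim_diff_quot M f g h : bounded_primitive M f g ->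
  exists N, bounded_primitive N (diff_quot h f) (diff_quot h g).
Proof.
move=> fg; have := bprimZ h^-1 (bprimD (bprim_shift h fg) (bprimZ (-1) fg)).
have E k : (fun x => h^-1 * (k (x + h) + -1 * k x)) = diff_quot h k.
  by apply/funext => x; rewrite mulN1r.
by rewrite !E => H; eexists; exact: H.
Qed.

(* With s = f(.+h) + f and w the difference quotient of f, one has
   w D_h(f g) = (s w^2)'/4 + s' w^2/4, and the first term integrates to 0. *)
Lemma transport_term_le M f g h : 0 < h -> bounded_primitive M f g ->
  (forall x, `|f x| <= M) -> L2 f -> L2 g ->
  `|ip (diff_quot h f) (diff_quot h (fun x => f x * g x))| <=
    M * sq (diff_quot h f).
Proof.
move=> h0 fg fM Lf Lg.
pose w := diff_quot h f; pose w' := diff_quot h g.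
pose s x := f (x + h) + f x; pose s' x := g (x + h) + g x.
have M0 := bprim_ge0 fg.
have sP : bounded_primitive (M + M) s s' := bprimD (bprim_shift h fg) fg.
have [N wP] := bprim_diff_quot h fg.
(* The Lipschitz bound on f controls w uniformly in h, so that w w and s w w are again bounded
   primitives. *)
have wM x : `|w x| <= M.
  rewrite /w /diff_quot normrM ger0_norm; last by rewrite invr_ge0 ltW.
  rewrite -(ler_pM2l h0) mulVKf ?gt_eqF // [h * M]mulrC.
  have xh : x <= x + h by rewrite lerDl ltW.
  by have := bprim_lipschitz_le fg xh; rewrite [x + h]addrC addrK.
have sM x : `|s x| <= M + M by apply: le_trans (ler_normD _ _) _; exact: lerD.
have Lw : L2 w := L2_diff_quot h Lf.
have Lw' : L2 w' := L2_diff_quot h Lg.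
have ww := bprimM wP wP wM wM.
have wwM x : `|w x * w x| <= M * M by rewrite normrM ler_pM.
have sww := bprimM sP ww sM wwM.
have ms := bprim_measurable_fun sP; have ms' := bprim_measurable sP.
have i2 : integ (fun x => w x ^+ 2) := Lw.2.
have iww : integ (fun x => w x * w x) := ip_integ Lw Lw.
have iww' : integ (fun x => w x * w' x) := ip_integ Lw Lw'.
have i0 : integ (fun x => s x * (w x * w x)) by exact: integ_boundM sM.
have j1 : integ (fun x => s' x * w x ^+ 2).
  by apply: integ_boundM (bprim_bound sP).
have j2 : integ (fun x => s x * (w x * w' x + w x * w' x)).
  by apply: integ_boundM sM => //; exact: integD.
have j3 : integ (fun x => s x * (w x * w' x + w x * w' x) + w x * w x * s' x).
  apply: integD => //; move: j1; congr integ.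
  by apply/funext => x; ring.
have z0 := Rintegral_bprim sww i0 j3.
(* Behind the identity: f g is the derivative of f^2 / 2 and D_h (f^2) = s w, so D_h (f g) = (s w)'
   / 2. *)
have -> : ip w (diff_quot h (fun x => f x * g x)) =
    4^-1 * \int[mu]_x (s x * (w x * w' x + w x * w' x) + w x * w x * s' x) +
    4^-1 * \int[mu]_x (s' x * w x ^+ 2).
  rewrite -!RintegralZl // -RintegralD //; [|exact: integZ|exact: integZ].
  apply: eq_Rintegral => x _; rewrite /w /w' /s /s' /diff_quot; field.
  by rewrite gt_eqF.
rewrite z0 mulr0 add0r normrM ger0_norm ?invr_ge0 //.
have : `|\int[mu]_x (s' x * w x ^+ 2)| <= (M + M) * sq w.
  rewrite /sq -RintegralZl //; apply: le_normr_Rint => //; first exact: integZ.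
  move=> x; rewrite normrM [`|w x ^+ 2|]ger0_norm ?sqr_ge0 //.
  by rewrite ler_wpM2r ?sqr_ge0 // (bprim_bound sP).
have := sq_ge0 w; nra.
Qed.

(** The constant is chosen before f, g, v and h. The left side is the time derivative of E_h when v
    is that of f; the equation splits it into two transport terms and two nonlocal ones. *)
Lemma energy_derivative_le M : exists2 C : R, 0 < C & forall f g v h,
  0 < h -> h <= 1 -> bounded_primitive M f g -> (forall x, `|f x| <= M) ->
  L2 f -> L2 g -> L2 v ->
  {ae mu, forall x, v x + f x * g x
     + convolution CH_kernel (fun y => f y ^+ 2 + 2^-1 * g y ^+ 2) x = 0} ->
  `|2 * ip f v + 2 * ip (diff_quot h f) (diff_quot h v)| <=
    C * (sq f + sq g).
Proof.
pose k1 : R := \int[mu]_y `|CH_kernel y|.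
pose k2 : R := expR 1 * (\int[mu]_x expR (- `|x|)) + 1.
have k1_ge0 : 0 <= k1 by apply: Rintegral_ge0.
have k2_ge0 : 0 <= k2.
  rewrite addr_ge0 // mulr_ge0 ?expR_ge0 //.
  by apply: Rintegral_ge0 => x _; exact: expR_ge0.
(* The first summand absorbs the transport terms. The second is Schur's test for the kernel and for
   its difference quotient, with 2 M^2 from [sqG] below. The final 1 makes C positive. *)
exists (4 * `|M| + (k1 + k2) * (1 + 2 * M ^+ 2) + 1).
  have a1 : 0 <= 4 * `|M| by rewrite mulr_ge0.
  have a2 : 0 <= (k1 + k2) * (1 + 2 * M ^+ 2).
    have := sqr_ge0 M => ?; apply: mulr_ge0; [exact: addr_ge0|lra].
  lra.
move=> f g v h h0 h1 fg fM Lf Lg Lv eqv.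
have M0 := bprim_ge0 fg.
have mf := L2_measurable Lf; have mg := L2_measurable Lg.
have mv := L2_measurable Lv.
pose G y := f y ^+ 2 + 2^-1 * g y ^+ 2.
have iG : integ G by apply: integD; [exact: Lf.2|exact: integZ Lg.2].
have gM := bprim_bound fg.
have sqM z : `|z| <= M -> z ^+ 2 <= M ^+ 2.
  by move=> zM; rewrite -[z ^+ 2]real_normK ?num_real // lerXn2r // nnegrE.
have G0 x : 0 <= G x by rewrite addr_ge0 ?sqr_ge0 // mulr_ge0 ?sqr_ge0.
(* One factor G is at most 3/2 M^2 and the other at most f^2 + g^2: the bound M makes the squared
   norm of the quadratic term linear in the energy. *)
have G2 x : G x ^+ 2 <= 2 * M ^+ 2 * (f x ^+ 2 + g x ^+ 2).
  have := sqM _ (fM x); have := sqM _ (gM x).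
  rewrite /G; have := sqr_ge0 (f x); have := sqr_ge0 (g x).
  move: (f x ^+ 2) (g x ^+ 2) (M ^+ 2) => a b c; nra.
have mG := integ_measurable iG.
have iE : integ (fun x => 2 * M ^+ 2 * (f x ^+ 2 + g x ^+ 2)).
  by apply/integZ/integD; [exact: Lf.2|exact: Lg.2].
have LG : L2 G.
  split => //; apply: integ_le iE _; first exact: measurable_funX.
  by move=> x; rewrite ger0_norm ?sqr_ge0.
have sqG : sq G <= 2 * M ^+ 2 * (sq f + sq g).
  rewrite /sq -RintegralD //; [|exact: Lf.2|exact: Lg.2].
  rewrite -RintegralZl //; last by apply: integD; [exact: Lf.2|exact: Lg.2].
  by apply: le_Rintegral => //; exact: LG.2.
pose P := convolution CH_kernel G.
have mP : measurable_fun setT P.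
  by apply: measurable_convolution => //; exact: integ_CH_kernel.
have Lfg : L2 (fun x => f x * g x).
  apply: (L2_le (c := M)) Lg _; first exact: measurable_funM.
  by move=> x; rewrite normrM ler_wpM2r.
have eqP' : {ae mu, forall x, v x = - (f x * g x) - P x}.
  apply: filterS eqv => x; rewrite -/(G) -/(P x) => H; apply/eqP.
  by rewrite -subr_eq0 -[X in _ == X]H; apply/eqP; ring.
(* Square integrability of P is read off the equation, as P = - v - f g almost everywhere. *)
have LP : L2 P.
  have L : L2 (fun x => -1 * v x - f x * g x) by apply: L2B => //; exact: L2Z.
  apply: ae_eq_L2 L _ => //; apply: filterS eqP' => x ->; ring.
pose Q x := f x * g x + P x.
have LQ : L2 Q by exact: L2D.
have vQ : {ae mu, forall x, v x = -1 * Q x}.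
  by apply: filterS eqP' => x ->; rewrite /Q; ring.
have e1 : ip f v = - (ip f (fun x => f x * g x) + ip f P).
  rewrite -ipDr // -mulN1r -ipZr //.
  apply: ae_eq_Rintegral; try by apply: measurable_funM => //; exact: (L2Z (-1) LQ).1.
  by apply: filterS vQ => x ->.
pose w := diff_quot h f.
have Lw : L2 w := L2_diff_quot h Lf.
have e2 : ip w (diff_quot h v) =
    - (ip w (diff_quot h (fun x => f x * g x)) + ip w (diff_quot h P)).
  rewrite -ipDr //; try exact: L2_diff_quot.
  rewrite -mulN1r -ipZr //; last by apply: L2D; exact: L2_diff_quot.
  apply: ae_eq_Rintegral.
  - by apply: measurable_funM; [exact: Lw.1|exact: (L2_diff_quot h Lv).1].
  - apply: measurable_funM; first exact: Lw.1.
    by apply: (L2Z (-1) _).1; apply: L2D; exact: L2_diff_quot.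
  have vQh := ae_shift h vQ.
  by apply: filterS2 vQ vQh => x e e'; rewrite /diff_quot e e' /Q; ring.
have b1 : `|ip f (fun x => f x * g x)| <= M * sq f.
  rewrite /ip /sq -RintegralZl //; last exact: Lf.2.
  apply: le_normr_Rint; [exact: ip_integ|exact: integZ Lf.2|move=> x].
  rewrite mulrA -expr2 normrM [`|f x ^+ 2|]ger0_norm ?sqr_ge0 // mulrC.
  by rewrite ler_wpM2r ?sqr_ge0.
have [_ b2] := schur_test integ_CH_kernel (@CH_kernel_bounded R) Lf iG LG.
have b3 := transport_term_le h0 fg fM Lf Lg.
have mK := @measurable_CH_kernel R.
have eP : diff_quot h P = convolution (diff_quot h CH_kernel) G.
  by apply/funext => x; exact: diff_quot_convolution mK (@CH_kernel_bounded R) iG.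
have [_ b4] := schur_test (integ_diff_quot_CH_kernel h)
  (fun y => diff_quot_CH_kernel_bounded y h0) Lw iG LG.
have k2le := Rintegral_diff_quot_CH_kernel h0 h1.
have wg := sq_diff_quot_le h0 fg Lf Lg.
have f0 := sq_ge0 f; have g0 := sq_ge0 g; have w0 := sq_ge0 w.
have sG0 := sq_ge0 G.
rewrite -/w in b3 b4 wg *; rewrite -eP in b4; rewrite -/P -/k1 in b2.
rewrite -/k2 in k2le.
have {}b4 : `|ip w (diff_quot h P)| <= 2^-1 * k2 * (sq w + sq G).
  apply: le_trans b4 _; rewrite ler_wpM2r ?addr_ge0 // ler_wpM2l //.
rewrite e1 e2.
set A1 := ip f _ in b1 *; set A2 := ip f P in b2 *.
set A3 := ip w _ in b3 *; set A4 := ip w (diff_quot h P) in b4 *.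
have H1 : `|2 * - (A1 + A2) + 2 * - (A3 + A4)| <=
    2 * (`|A1| + `|A2| + `|A3| + `|A4|).
  have -> : 2 * - (A1 + A2) + 2 * - (A3 + A4) = - (2 * (A1 + A2 + A3 + A4)).
    by ring.
  rewrite normrN normrM ger0_norm // ler_wpM2l //.
  by do 3 (apply: le_trans (ler_normD _ _) _; rewrite lerD2r //).
apply: le_trans H1 _.
rewrite [`|M|]ger0_norm //.
have M2 : 0 <= M ^+ 2 by exact: sqr_ge0.
have c1 : M * sq w <= M * sq g by rewrite ler_wpM2l.
have c2 : k1 * (sq f + sq G) <= k1 * ((1 + 2 * M ^+ 2) * (sq f + sq g)).
  by rewrite ler_wpM2l //; lra.
have c3 : k2 * (sq w + sq G) <= k2 * ((1 + 2 * M ^+ 2) * (sq f + sq g)).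
  by rewrite ler_wpM2l //; lra.
have c4 : 0 <= M * sq f by rewrite mulr_ge0.
have c5 : 0 <= M * sq g by rewrite mulr_ge0.
lra.
Qed.

End EnergyEstimate.

(** * Weak derivatives are primitives *)

Section BumpFunctions.
Context {R : realType}.
Notation mu := (@lebesgue_measure R).
Implicit Types (f g phi : R -> R) (p : {poly R}) (x y z a b : R).

(** Keep only the term of degree k + 2 in the series of exp (1/z). The surviving factor z^2 yields a
    zero derivative at the ends of a bump. *)
Lemma exprV_expRV_le (k : nat) (z : R) : 0 < z ->
  z^-1 ^+ k * expR (- z^-1) <= (k.+2)`!%:R * z ^+ 2.
Proof.
move=> z0; have zi : 0 < z^-1 by rewrite invr_gt0.
have e := @expR_ge1Dxn R z^-1 k.+1 (ltW zi).
have f0 : 0 < (k.+2)`!%:R :> R by rewrite ltr0n fact_gt0.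
rewrite expRN ler_pdivrMr ?expR_gt0 //.
have -> : z^-1 ^+ k = (k.+2)`!%:R * z ^+ 2 * (z^-1 ^+ k.+2 / (k.+2)`!%:R).
  by rewrite !exprS expr0; field; rewrite !gt_eqF.
apply: ler_wpM2l; first by rewrite mulr_ge0 ?sqr_ge0 // ltW.
by apply: le_trans e; rewrite lerDr.
Qed.

Definition bump_poly a b : {poly R} := ('X - a%:P) * (b%:P - 'X).

(** The functions p Q^-k exp (-1/Q) with Q = (x - a)(b - x), extended by 0. The parameters p and k
    make the family closed under differentiation, which gives smoothness by induction. *)
Definition bump_fun p (k : nat) a b x : R :=
  if (a < x) && (x < b) then
    p.[x] * (bump_poly a b).[x]^-1 ^+ k * expR (- (bump_poly a b).[x]^-1)
  else 0.

Lemma bump_polyE a b x : (bump_poly a b).[x] = (x - a) * (b - x).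
Proof. by rewrite !hornerE. Qed.

Lemma bump_poly_gt0 a b x : a < x -> x < b -> 0 < (bump_poly a b).[x].
Proof. by move=> ax xb; rewrite bump_polyE mulr_gt0 ?subr_gt0. Qed.

Lemma is_derive_sqr_bound f x C : f x = 0 ->
  (forall y, `|f y| <= C * (y - x) ^+ 2) -> is_derive x 1 f 0.
Proof.
move=> fx fC.
suff H : h^-1 *: (f (h *: 1 + x) - f x) @[h --> 0^'] --> 0.
  by split; [apply/cvg_ex; exists 0|apply/cvg_lim].
have c1 : C * `|h| @[h --> (0 : R)^'] --> C * 0.
  apply: cvgM; first exact: cvg_cst.
  by rewrite -[X in _ --> X](@normr0 _ R); apply: cvg_norm; exact: nbhs_dnbhs.
rewrite mulr0 in c1; apply/norm_cvg0P; apply: (squeeze_cvgr _ (cvg_cst 0) c1).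
have n0 : \forall h \near (0 : R)^', h != 0 :> R by exact: nbhs_dnbhs_neq.
apply: filterS n0 => h h0; rewrite normr_ge0 /= fx subr0 normrM normfV.
rewrite mulrC ler_pdivrMr ?normr_gt0 //; apply: le_trans (fC _) _.
by rewrite [h *: 1]mulr1 addrK -[h ^+ 2]real_normK ?num_real // expr2 mulrA.
Qed.

(** Inside the interval, (p Q^-k exp (-1/Q))' has the common factor Q^-(k+2) exp (-1/Q), leaving p'
    Q^2 - k p Q Q' + p Q'. Elsewhere, endpoints included, the function is O((y - x)^2) around x. *)
Lemma bump_fun_derive p k a b x : a < b ->
  is_derive x 1 (bump_fun p k a b)
   (bump_fun (p^`() * bump_poly a b ^+ 2 - (p * bump_poly a b * (bump_poly a b)^`()) *+ k
      + p * (bump_poly a b)^`()) k.+2 a b x).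
Proof.
move=> ab; set Q := bump_poly a b; set p2 := (X in bump_fun X k.+2).
have [/andP[ax xb]|xn] := boolP ((a < x) && (x < b)).
  have Q0 : 0 < Q.[x] by exact: bump_poly_gt0.
  apply: (@near_eq_is_derive _ _ _
    (fun z => p.[z] * Q.[z]^-1 ^+ k * expR (- Q.[z]^-1))).
    near=> z; rewrite /bump_fun ifT //; apply/andP; split; near: z.
      exact: lt_nbhsr.
    exact: lt_nbhsl.
  have Dr : is_derive x 1 (fun z => Q.[z]^-1) (- Q.[x] ^- 2 *: Q^`().[x]).
    by apply: is_deriveV; rewrite gt_eqF.
  have Drk : is_derive x 1 (fun z => Q.[z]^-1 ^+ k)
     (k%:R * Q.[x]^-1 ^+ k.-1 *: (- Q.[x] ^- 2 *: Q^`().[x])).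
    have -> : (fun z => Q.[z]^-1 ^+ k) = (fun z => Q.[z]^-1) ^+ k.
      by rewrite exprfctE.
    exact: is_deriveX.
  have De : is_derive x 1 (fun z => expR (- Q.[z]^-1))
    (expR (- Q.[x]^-1) * - (- Q.[x] ^- 2 *: Q^`().[x])).
    exact: (@is_derive1_comp _ expR (fun z => - Q.[z]^-1)).
  have Dp : is_derive x 1 (fun z => p.[z] * Q.[z]^-1 ^+ k)
   (p.[x] *: (k%:R * Q.[x]^-1 ^+ k.-1 *: (- Q.[x] ^- 2 *: Q^`().[x]))
    + Q.[x]^-1 ^+ k *: p^`().[x]).
    exact: (@is_deriveM _ _ (horner p) (fun z => Q.[z]^-1 ^+ k)).
  apply: (@is_derive_eq _ _ _ _ _ _ _ _ (is_deriveM Dp De)).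
  have p2E : p2.[x] = p^`().[x] * Q.[x] ^+ 2 -
      (p.[x] * Q.[x] * Q^`().[x]) *+ k + p.[x] * Q^`().[x].
    rewrite /p2; move: (Q) => q.
    by rewrite !(hornerD, hornerN, hornerMn, hornerM, horner_exp).
  rewrite /bump_fun ifT ?ax ?xb // -/Q p2E.
  rewrite -![_ *: _]/(_ * _).
  have e1 : Q.[x]^-1 ^+ k.+2 = Q.[x]^-1 ^+ k * Q.[x]^-1 ^+ 2.
    by rewrite -exprD addn2.
  (* For k = 0 the truncated predecessor is harmless, both sides being 0. *)
  have e2 : k%:R * Q.[x]^-1 ^+ k.-1 = k%:R * Q.[x]^-1 ^+ k * Q.[x].
    case: (k) => [|j]; first by rewrite !mul0r.
    rewrite exprS /= -[RHS]mulrA; congr (_ * _).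
    by rewrite mulrAC mulVf ?gt_eqF // mul1r.
  rewrite e1 e2 -[_ *+ k]mulr_natr; field.
  by rewrite gt_eqF.
have bx : bump_fun p k a b x = 0 by rewrite /bump_fun (negbTE xn).
have -> : bump_fun p2 k.+2 a b x = 0 by rewrite /bump_fun (negbTE xn).
have [C pC] := poly_itv_bound p a b.
pose D := `|C| * ((k.+2)`!%:R * (b - a) ^+ 2).
have D0 : 0 <= D by apply: mulr_ge0 => //; apply: mulr_ge0 => //; exact: sqr_ge0.
apply: (is_derive_sqr_bound (C := D)) => // y.
rewrite /bump_fun; case: ifP => [/andP[ay yb]|_]; last first.
  by rewrite normr0; apply: mulr_ge0 => //; exact: sqr_ge0.
have Q0 := bump_poly_gt0 ay yb.
(* As x is outside the interval and y inside, the factor of Q y vanishing at the end nearer to x is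
   at most |y - x|, and the other is at most b - a. *)
have Qle : Q.[y] ^+ 2 <= (b - a) ^+ 2 * (y - x) ^+ 2.
  rewrite -exprMn -[leRHS]real_normK ?num_real // lerXn2r ?nnegrE ?(ltW Q0) //.
  rewrite normrM [`|b - a|]gtr0_norm ?subr_gt0 // /Q bump_polyE.
  move: xn; rewrite negb_and -!leNgt => /orP[xa|bx'].
    have -> : `|y - x| = y - x by rewrite ger0_norm // subr_ge0 (le_trans xa) ?ltW.
    nra.
  have -> : `|y - x| = x - y.
    by rewrite distrC ger0_norm // subr_ge0 (le_trans _ bx') ?ltW.
  nra.
have -> : D * (y - x) ^+ 2 =
    `|C| * ((k.+2)`!%:R * ((b - a) ^+ 2 * (y - x) ^+ 2)).
  by rewrite /D; move: (_`!%:R : R) => F; ring.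
rewrite -mulrA normrM ler_pM //.
  by apply: le_trans (ler_norm C); apply: pC; rewrite !ltW.
rewrite ger0_norm; last by rewrite mulr_ge0 ?expR_ge0 // exprn_ge0 // invr_ge0 ltW.
apply: le_trans (exprV_expRV_le k Q0) _.
by apply: ler_wpM2l; [exact: ler0n|exact: Qle].
Unshelve. all: by end_near. Qed.

End BumpFunctions.

(** * Unit-mass bumps, smoothed indicators and the weak derivative as a derivative in the integral
    sense *)

Section Mollifiers.
Context {R : realType}.
Notation mu := (@lebesgue_measure R).
Implicit Types (f g phi : R -> R) (p : {poly R}) (x y z a b c : R).

(** Smoothness is thus proved by exhibiting a class closed under differentiation, without any
    formula for the n-th derivative. *)
Lemma derivable_class (S : set (R -> R)) :
  (forall f, S f -> exists2 g, S g & forall x, is_derive x 1 f (g x)) ->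
  forall f, S f -> forall (n : nat) x, derivable (derive1n n f) x 1.
Proof.
move=> SD f Sf n x.
have H m : S (derive1n m f).
  elim: m => [//|m /SD[g Sg fg]]; rewrite derive1nS.
  suff -> : ((derive1n m f)^`())%classic = g by [].
  by apply/funext => z; rewrite derive1E; have := fg z; case.
by have [g _ /(_ x)[]] := SD _ (H n).
Qed.

Lemma is_derive_continuous f g : (forall x, is_derive x 1 f (g x)) ->
  continuous f.
Proof.
move=> fg x; apply: differentiable_continuous; apply/derivable1_diffP.
by have [] := fg x.
Qed.

Lemma continuous_bump_fun p k a b : a < b -> continuous (bump_fun p k a b).
Proof.
by move=> ab; apply: is_derive_continuous => x; exact: bump_fun_derive.
Qed.

Lemma measurable_bump_fun p k a b : a < b ->
  measurable_fun setT (bump_fun p k a b).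
Proof.
by move=> ab; apply: continuous_measurable_fun; exact: continuous_bump_fun.
Qed.

Lemma bump_fun_out p k a b x : ~~ (x \in `]a, b[) -> bump_fun p k a b x = 0.
Proof. by rewrite in_itv /= /bump_fun => /negbTE ->. Qed.

Lemma bump_funC_ge0 c a b x : 0 <= c -> 0 <= bump_fun c%:P 0 a b x.
Proof.
move=> c0; rewrite /bump_fun; case: ifP => // _.
by rewrite hornerC expr0 mulr1 mulr_ge0 ?expR_ge0.
Qed.

Lemma bump_funC_le c a b x : 0 <= c -> bump_fun c%:P 0 a b x <= c.
Proof.
move=> c0; rewrite /bump_fun; case: ifP => // /andP[ax xb].
rewrite hornerC expr0 mulr1 ler_piMr // -expR0 ler_expR oppr_le0 invr_ge0.
by rewrite ltW // bump_poly_gt0.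
Qed.

Lemma bump_funCM c a b x : bump_fun c%:P 0 a b x = c * bump_fun 1%:P 0 a b x.
Proof.
rewrite /bump_fun; case: ifP => _; last by rewrite mulr0.
by rewrite !hornerC expr0 !mulr1 mul1r.
Qed.

Lemma integ_local_mul f (k : R -> R) C a b : locally_integrable setT f ->
  measurable_fun setT k -> (forall x, `|k x| <= C) ->
  (forall x, ~~ (x \in `[a, b]) -> k x = 0) -> integ (fun x => f x * k x).
Proof.
move=> lf mk kC k0.
have ir : integ (f \_ `[a, b]).
  rewrite /integ -restrict_EFin.
  apply/integrable_restrict => //=; rewrite setTI.
  exact: integrable_itv_locally.
have -> : (fun x => f x * k x) = (fun x => k x * (f \_ `[a, b]) x).
  apply/funext => x; rewrite patchE mem_setE; case: ifP => [_|/negbT /k0 ->].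
    by rewrite mulrC.
  by rewrite mulr0 mul0r.
exact: integ_boundM kC.
Qed.

Lemma locally_integrable_cst c : locally_integrable setT (fun=> c : R).
Proof.
split => //; first exact: openT.
move=> K _ cK; have mK := compact_measurable cK.
rewrite integral_cst //; apply: lte_mul_pinfty => //.
exact: compact_finite_measure.
Qed.

Lemma integ_bump_funC c a b : a < b -> 0 <= c -> integ (bump_fun c%:P 0 a b).
Proof.
move=> ab c0; have := @integ_local_mul (fun=> 1) (bump_fun c%:P 0 a b) c a b.
under [X in _ -> _ -> _ -> _ -> integ X]eq_fun do rewrite mul1r.
apply.
- exact: locally_integrable_cst.
- exact: measurable_bump_fun.
- by move=> x; rewrite ger0_norm ?bump_funC_ge0 // bump_funC_le.
- move=> x xab; apply: bump_fun_out; apply: contra xab.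
  by rewrite !in_itv /= => /andP[/ltW -> /ltW ->].
Qed.

Lemma Rintegral_bump_gt0 a b : a < b -> 0 < \int[mu]_x bump_fun 1%:P 0 a b x.
Proof.
move=> ab; have ib := integ_bump_funC ab (@ler01 R).
rewrite lt_neqAle eq_sym Rintegral_ge0 ?andbT; last first.
  by move=> x _; exact: bump_funC_ge0.
apply/negP => /eqP I0.
have : (\int[mu]_x `|(bump_fun 1%:P 0 a b x)%:E| = 0)%E.
  under eq_integral do rewrite /= ger0_norm ?bump_funC_ge0 //.
  rewrite -[LHS]fineK; last exact: integrable_fin_num.
  by rewrite -[fine _]/(\int[mu]_x bump_fun 1%:P 0 a b x) I0.
move/(ae_eq_integral_abs mu measurableT (measurable_int mu ib)) => [N [mN N0 NS]].
have : (mu (`]a, b[%classic : set R) <= mu N)%E.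
  apply: le_measure; [by rewrite inE|by rewrite inE|].
  apply: subset_trans NS => x /=; rewrite in_itv /= => xab H.
  move: (H I) => [] /eqP; rewrite /bump_fun xab hornerC expr0 !mul1r.
  by rewrite gt_eqF ?expR_gt0.
by rewrite N0 lebesgue_measure_itv /= lte_fin ab -EFinB lee_fin leNgt subr_gt0 ab.
Qed.

Lemma normrB_le1 (s t : R) : 0 <= s -> s <= 1 -> 0 <= t -> t <= 1 ->
  `|s - t| <= 1.
Proof. by move=> ? ? ? ?; rewrite ler_norml; apply/andP; split; lra. Qed.

(** A bump normalised on the interval itself rather than a rescaled fixed profile, so that no change
    of variables occurs. *)
Definition mollifier a b : R -> R :=
  bump_fun (\int[mu]_x bump_fun 1%:P 0 a b x)^-1%:P 0 a b.

Lemma mollifier_ge0 a b x : 0 <= mollifier a b x.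
Proof.
apply: bump_funC_ge0; rewrite invr_ge0; apply: Rintegral_ge0 => z _.
exact: bump_funC_ge0.
Qed.

Lemma mollifier_bound a b x :
  `|mollifier a b x| <= (\int[mu]_x bump_fun 1%:P 0 a b x)^-1.
Proof.
rewrite ger0_norm ?mollifier_ge0 //; apply: bump_funC_le.
by rewrite invr_ge0; apply: Rintegral_ge0 => z _; exact: bump_funC_ge0.
Qed.

Lemma mollifier_out a b x : ~~ (x \in `]a, b[) -> mollifier a b x = 0.
Proof. exact: bump_fun_out. Qed.

Lemma mollifier_out_itvcc a b x : ~~ (x \in `[a, b]) -> mollifier a b x = 0.
Proof.
move=> xab; apply: mollifier_out; apply: contra xab.
by rewrite !in_itv /= => /andP[/ltW -> /ltW ->].
Qed.

Lemma integ_mollifier a b : a < b -> integ (mollifier a b).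
Proof.
move=> ab; apply: integ_bump_funC => //.
by rewrite invr_ge0; apply: Rintegral_ge0 => z _; exact: bump_funC_ge0.
Qed.

Lemma continuous_mollifier a b : a < b -> continuous (mollifier a b).
Proof. exact: continuous_bump_fun. Qed.

Lemma measurable_mollifier a b : a < b -> measurable_fun setT (mollifier a b).
Proof. exact: measurable_bump_fun. Qed.

Lemma Rintegral_mollifier a b : a < b -> \int[mu]_x mollifier a b x = 1.
Proof.
move=> ab; under eq_Rintegral do rewrite /mollifier bump_funCM.
rewrite RintegralZl //; last exact: integ_bump_funC.
by rewrite mulVf // gt_eqF // Rintegral_bump_gt0.
Qed.

(** A smooth passage from 0 to 1 across [a, b] when a < b; the difference of two of them is a
    smoothed indicator. *)
Definition smooth_step a b x : R := \int[mu]_(z in `]-oo, x]) mollifier a b z.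

Lemma smooth_step_derive a b x : a < b ->
  is_derive x 1 (smooth_step a b) (mollifier a b x).
Proof.
move=> ab; have im := integ_mollifier ab.
have im1 : mu.-integrable [set` Interval -oo%O (BRight (x + 1))]
    (EFin \o mollifier a b).
  exact: integrableS im.
have cm := @continuous_mollifier a b ab x.
have x1 : x < x + 1 by rewrite ltrDl.
have [|d e] := continuous_FTC1 x1 im1 _ cm; first by rewrite ltNyr.
split; [exact: d|by rewrite -derive1E; exact: e].
Qed.

Lemma smooth_step_ge0 a b x : 0 <= smooth_step a b x.
Proof. by apply: Rintegral_ge0 => z _; exact: mollifier_ge0. Qed.

Lemma smooth_stepE a b x :
  smooth_step a b x = \int[mu]_z (mollifier a b \_ `]-oo, x]) z.
Proof. by rewrite /smooth_step Rintegral_mkcond. Qed.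

Lemma smooth_step_le1 a b x : a < b -> smooth_step a b x <= 1.
Proof.
move=> ab; have im := integ_mollifier ab.
rewrite smooth_stepE -(Rintegral_mollifier ab); apply: le_Rintegral => //.
  rewrite -restrict_EFin; apply/integrable_restrict => //=; rewrite setTI.
  exact: integrableS im.
by move=> z _; rewrite patchE; case: ifP => // _; exact: mollifier_ge0.
Qed.

Lemma smooth_step0 a b x : x <= a -> smooth_step a b x = 0.
Proof.
move=> xa; rewrite smooth_stepE -[RHS](mul0r (fine (mu [set: R]))).
rewrite -Rintegral_cst //; apply: eq_Rintegral => z _.
rewrite patchE mem_setE in_itv /=; case: ifP => // zx; apply: mollifier_out.
by rewrite in_itv /= negb_and -leNgt (le_trans zx xa).
Qed.

Lemma smooth_step1 a b x : a < b -> b <= x -> smooth_step a b x = 1.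
Proof.
move=> ab bx; rewrite smooth_stepE -(Rintegral_mollifier ab).
apply: eq_Rintegral => z _.
rewrite patchE mem_setE in_itv /=; case: ifPn => //; rewrite -ltNge => xz.
apply/esym/mollifier_out.
by rewrite in_itv /= negb_and orbC -leNgt (le_trans bx) // ltW.
Qed.

Lemma test_function_window a b c d : a < b -> c < d ->
  test_function (fun x => smooth_step a b x - smooth_step c d x).
Proof.
move=> ab cd; split.
  pose phi x := smooth_step a b x - smooth_step c d x.
  (* The window itself is not a sum of bumps, but its derivative, a difference of two mollifiers,
     is; from there on the class is stable. *)
  pose S f := f = phi \/ exists p q k l,
    f = (fun x => bump_fun p k a b x + bump_fun q l c d x).
  apply: (@derivable_class S) => [f|]; last by left.
  case=> [->|[p [q [k [l ->]]]]].
    exists (fun x => mollifier a b x - mollifier c d x).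
      right; exists (\int[mu]_x bump_fun 1%:P 0 a b x)^-1%:P.
      exists (- (\int[mu]_x bump_fun 1%:P 0 c d x)^-1)%:P, 0%N, 0%N.
      apply/funext => x; congr (_ + _).
      by rewrite /mollifier bump_funCM [RHS]bump_funCM mulNr.
    by move=> x; apply: is_deriveB; exact: smooth_step_derive.
  eexists; last by move=> x; apply: is_deriveD; exact: bump_fun_derive.
  by right; do 4 eexists.
pose m := Num.min a c; pose M := Num.max b d.
have cl : closed (`[m, M]%classic : set R) by exact: itv_closed.
apply: (subclosed_compact (@closed_closure _ _) (@segment_compact R m M)).
rewrite [X in _ `<=` X](closure_id _).1 //; apply: closureS => x /=.
apply: contraNP => /negP; rewrite in_itv /= negb_and -!ltNge => /orP[xm|Mx].
  by rewrite !smooth_step0 ?subrr //; move: xm; rewrite lt_min => /andP[/ltW ? /ltW ?].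
by rewrite !smooth_step1 ?subrr //; move: Mx; rewrite gt_max => /andP[/ltW ? /ltW ?].
Qed.

Lemma mollifier_cvg f x : continuous f -> locally_integrable setT f ->
  \int[mu]_z (f z * mollifier x (x + n.+1%:R^-1) z) @[n --> \oo] --> f x.
Proof.
move=> cf lf.
have xn n : x < x + n.+1%:R^-1 by rewrite ltrDl invr_gt0 ltr0n.
have im n := integ_mollifier (xn n).
have ifm n : integ (fun z => f z * mollifier x (x + n.+1%:R^-1) z).
  apply: (integ_local_mul lf (measurable_mollifier (xn n))).
    by move=> z; exact: mollifier_bound.
  by move=> z; exact: mollifier_out_itvcc.
apply/cvgrPdist_le => e e0.
have [d /= d0 dP] : \forall z \near x, `|f x - f z| <= e.
  by have /cvgrPdist_le := cf x; apply.
near=> n.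
have nd : n.+1%:R^-1 < d by near: n; exact: (near_infty_natSinv_lt (PosNum d0)).
have cstE c : \int[mu]_z (c * mollifier x (x + n.+1%:R^-1) z) = c.
  rewrite RintegralZl //; last exact: im.
  by rewrite Rintegral_mollifier // mulr1.
rewrite distrC -[f x]cstE -[leRHS]cstE.
rewrite -RintegralB //; [|exact: ifm|exact: integZ].
apply: le_normr_Rint; [by apply: integB => //; exact: integZ|exact: integZ|].
move=> z; rewrite -mulrBl normrM [`|mollifier _ _ _|]ger0_norm ?mollifier_ge0 //.
have [zx|/mollifier_out ->] := boolP (z \in `]x, x + n.+1%:R^-1[); last first.
  by rewrite !mulr0.
rewrite ler_wpM2r ?mollifier_ge0 // distrC; apply: dP => /=.
move: zx; rewrite in_itv /= => /andP[xz zxn].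
by rewrite ltr0_norm ?subr_lt0 // opprB ltrBlDl (lt_trans zxn) // ltrD2l.
Unshelve. all: by end_near. Qed.

(** The limit at z = x is 0 because the step only starts there; hence the limiting window below is
    the half-open ]x, y]. *)
Lemma smooth_step_cvg x z :
  smooth_step x (x + n.+1%:R^-1) z @[n --> \oo] --> (if z <= x then 0 else 1 : R).
Proof.
have xn n : x < x + n.+1%:R^-1 by rewrite ltrDl invr_gt0 ltr0n.
case: ifPn => [zx|]; last rewrite -ltNge => xz.
  by under eq_fun do rewrite smooth_step0 //; exact: cvg_cst.
have d0 : 0 < z - x by rewrite subr_gt0.
apply: cvg_near_cst.
near=> n; apply: smooth_step1 => //.
rewrite -lerBrDl ltW //; near: n; exact: (near_infty_natSinv_lt (PosNum d0)).
Unshelve. all: by end_near. Qed.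

(** The window phi n has as derivative a mollifier at x minus one at y, so the left side of the weak
    formulation tends to f x - f y by continuity of f. The right side converges by dominated
    convergence. *)
Lemma weak_derivative_primitive f g : continuous f ->
  is_weak_derivative f g -> primitive f g.
Proof.
move=> cf [lf lg fg] x y; rewrite le_eqVlt => /predU1P[->|xy].
  by rewrite subrr set_itv1 Rintegral_set1.
pose r n : R := n.+1%:R^-1.
have r0 n : 0 < r n by rewrite invr_gt0 ltr0n.
have r1 n : r n <= 1 by rewrite invf_le1 ?ler1n // ltr0n.
have xn n : x < x + r n by rewrite ltrDl.
have yn n : y < y + r n by rewrite ltrDl.
pose phi n z := smooth_step x (x + r n) z - smooth_step y (y + r n) z.
have phi' n z : is_derive z 1 (phi n)
    (mollifier x (x + r n) z - mollifier y (y + r n) z).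
  by apply: is_deriveB; exact: smooth_step_derive.
have ifm w n : w < w + r n -> integ (fun z => f z * mollifier w (w + r n) z).
  move=> wn; apply: (integ_local_mul lf (measurable_mollifier wn)).
    by move=> z; exact: mollifier_bound.
  by move=> z; exact: mollifier_out_itvcc.
have H n : \int[mu]_z (f z * mollifier x (x + r n) z) -
    \int[mu]_z (f z * mollifier y (y + r n) z) = - \int[mu]_z (g z * phi n z).
  rewrite -(fg _ (test_function_window (xn n) (yn n))).
  rewrite -RintegralB //; [|exact: ifm|exact: ifm].
  apply: eq_Rintegral => z _; rewrite -mulrBr; congr (_ * _).
  by rewrite derive1E; have [_ ->] := phi' n z.
have c1 := mollifier_cvg (x := x) cf lf.
have c2 := mollifier_cvg (x := y) cf lf.
have c3 : (- (\int[mu]_z (g z * phi n z))) @[n --> \oo] --> f x - f y.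
  by under eq_fun do rewrite -H; exact: cvgB c1 c2.
have phi0 n z : ~~ (z \in `[x, y + 1]) -> phi n z = 0.
  rewrite in_itv /= negb_and -!ltNge => /orP[zx|yz].
    by rewrite /phi !smooth_step0 ?subrr // ltW // (lt_trans zx).
  rewrite /phi !smooth_step1 ?subrr //.
    by rewrite ltW // (le_lt_trans _ yz) // lerD2l.
  by rewrite ltW // (le_lt_trans _ yz) // lerD // ltW.
have phi1 n z : `|phi n z| <= 1.
  by apply: normrB_le1; rewrite ?smooth_step_ge0 ?smooth_step_le1.
have mphi n : measurable_fun setT (phi n).
  by apply: continuous_measurable_fun; exact: is_derive_continuous (phi' n).
have mg : measurable_fun setT g by case: lg.
(* The dominating function: all windows live in [x, y + 1] because r n <= 1. *)
have i1 : integ (fun z => g z * (\1_(`[x, y + 1]%classic) z)).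
  apply: (integ_local_mul (C := 1) (a := x) (b := y + 1) lg).
  - exact: measurable_indic.
  - by move=> z; rewrite indicE; case: (_ \in _); rewrite ?normr1 ?normr0.
  - by move=> z zxy; rewrite indicE mem_setE (negbTE zxy).
have c4 : \int[mu]_z (g z * phi n z) @[n --> \oo] -->
    \int[mu]_(z in `]x, y]) g z.
  pose G z := g z * \1_(`]x, y]%classic) z.
  pose F n z := (g z * phi n z)%:E.
  have mF n : measurable_fun setT (F n).
    by apply/measurable_EFinP; exact: measurable_funM.
  have mG : measurable_fun setT (EFin \o G).
    apply/measurable_EFinP; apply: measurable_funM; first exact: mg.
    exact: measurable_indic.
  have FG z : F n z @[n --> \oo] --> (EFin \o G) z.
    apply: cvg_EFin; first exact: nearW.
    have -> : G z = g z * ((if z <= x then 0 else 1) - (if z <= y then 0 else 1)).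
      rewrite /G indicE mem_setE in_itv /=; have [zx|xz] := leP z x.
        by rewrite (le_trans zx (ltW xy)) subrr mulr0.
      by case: ifP => /= _; rewrite ?subr0 ?subrr.
    apply: cvgM; first exact: cvg_cst.
    by apply: cvgB; exact: smooth_step_cvg.
  have FG' : {ae mu, forall z, setT z -> F n z @[n --> \oo] --> (EFin \o G) z}.
    by apply: nearW.
  have dom : {ae mu, forall z, forall n, setT z ->
      (`|F n z| <= `|g z * (\1_(`[x, y + 1]%classic) z)|%:E)%E}.
    apply: nearW => z n _; rewrite /F /= lee_fin indicE mem_setE.
    case: (boolP (z \in `[x, y + 1])) => [_|/phi0 ->]; last by rewrite !mulr0 normr0.
    by rewrite mulr1 normrM ler_piMr.
  have [iG _ cI] := @dominated_convergence _ _ _ mu setT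
    (@measurableT _ _) F (EFin \o G) _ mF mG FG'
    (integ_norm i1) dom.
  have -> : \int[mu]_(z in `]x, y]) g z = \int[mu]_z G z.
    rewrite Rintegral_mkcond; apply: eq_Rintegral => z _.
    by rewrite /G patchE indicE; case: ifP; rewrite ?mulr1 ?mulr0.
  apply: fine_cvg; rewrite fineK //; last exact: integrable_fin_num.
have -> : \int[mu]_(z in `[x, y]) g z = \int[mu]_(z in `]x, y]) g z.
  rewrite -Rintegral_itv_obnd_cbnd //.
  by apply: integrableS (integrable_itv_locally x y lg) => //;
    apply: subset_itvr; rewrite bnd_simp.
have E : f x - f y = - \int[mu]_(z in `]x, y]) g z.
  by apply: (cvg_unique _ c3 (cvgN c4)); exact: Rhausdorff.
by rewrite -opprB E opprK.
Qed.

End Mollifiers.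

(** * Continuous representatives *)

Section Representatives.
Context {R : realType}.
Notation mu := (@lebesgue_measure R).
Implicit Types (f g w : R -> R) (x y z h t M : R).

Lemma ae_exists_itv (P : R -> Prop) x y : {ae mu, forall z, P z} -> x < y ->
  exists2 z, z \in `]x, y[ & P z.
Proof.
move=> [N [mN N0 PN]] xy; apply: contrapT => nP.
have : (mu (`]x, y[%classic : set R) <= mu N)%E.
  apply: le_measure; [by rewrite inE|by rewrite inE|].
  apply: subset_trans PN => z /= zxy Pz; apply: nP; exists z => //.
by rewrite N0 lebesgue_measure_itv /= lte_fin xy -EFinB lee_fin leNgt subr_gt0 xy.
Qed.

Lemma continuous_ae_le f M : continuous f -> {ae mu, forall x, f x <= M} ->
  forall x, f x <= M.
Proof.
move=> cf fM x; rewrite leNgt; apply/negP => Mf.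
have [e /= e0 eP] : \forall z \near x, M < f z.
  exact: cvgr_gt (cf x) _ Mf.
have xe : x - e < x + e by lra.
have [z] := ae_exists_itv fM xe.
rewrite in_itv /= => /andP[z1 z2]; apply/negP; rewrite -ltNge; apply: eP => /=.
by rewrite ltr_norml; apply/andP; split; lra.
Qed.

Lemma continuous_ae_norm_le f M : continuous f ->
  {ae mu, forall x, `|f x| <= M} -> forall x, `|f x| <= M.
Proof.
move=> cf; apply: continuous_ae_le => x.
by apply: (continuous_comp (cf x)); exact: norm_continuous.
Qed.

Lemma sq_eq0_ae f : L2 f -> sq f = 0 -> {ae mu, forall x, f x = 0}.
Proof.
move=> Lf f0.
have mf2 : measurable_fun setT (fun x => (f x ^+ 2)%:E).
  by apply/measurable_EFinP; apply: measurable_funX; exact: Lf.1.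
have : (\int[mu]_x `|(f x ^+ 2)%:E| = 0)%E.
  under eq_integral do rewrite gee0_abs ?lee_fin ?sqr_ge0 //.
  by rewrite sqE // f0.
move/(ae_eq_integral_abs mu measurableT mf2); apply: filterS => x H.
by move: (H I) => [] /eqP; rewrite sqrf_eq0 => /eqP.
Qed.

Lemma continuous_sq_eq0 f : continuous f -> L2 f -> sq f = 0 ->
  forall x, f x = 0.
Proof.
move=> cf Lf f0 x; apply/eqP; rewrite -normr_le0.
apply: continuous_ae_norm_le cf _ _.
by apply: filterS (sq_eq0_ae Lf f0) => z ->; rewrite normr0.
Qed.

(** Both are almost everywhere the limit of the same difference quotients of f. *)
Lemma primitive_ae_unique f g1 g2 : locally_integrable setT g1 ->
  locally_integrable setT g2 -> primitive f g1 -> primitive f g2 ->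
  {ae mu, forall x, g1 x = g2 x}.
Proof.
move=> l1 l2 p1 p2.
apply: filterS2 (diff_quot_ae_cvg l1 p1) (diff_quot_ae_cvg l2 p2) => x c1 c2.
by apply: (cvg_unique _ c1 c2); exact: Rhausdorff.
Qed.

Lemma weak_deriveP f g : is_weak_derivative f g ->
  is_weak_derivative f (weak_derive f).
Proof. by move=> fg; apply: (xgetI _ (P := [set g | is_weak_derivative f g])) fg. Qed.

Lemma weak_derive_unique f g : continuous f -> is_weak_derivative f g ->
  {ae mu, forall x, weak_derive f x = g x}.
Proof.
move=> cf fg; have fw := weak_deriveP fg.
have pg := weak_derivative_primitive cf fg.
have pw := weak_derivative_primitive cf fw.
by case: fg fw => [_ lg _] [_ lw _]; exact: primitive_ae_unique pw pg.
Qed.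

Lemma in_H1P f : continuous f -> in_H1 f ->
  [/\ L2 f, L2 (weak_derive f), locally_integrable setT (weak_derive f) &
    primitive f (weak_derive f)].
Proof.
move=> cf [/Lfun2P Lf [g fg /Lfun2P Lg]].
have fw := weak_deriveP fg; have pw := weak_derivative_primitive cf fw.
have ae := weak_derive_unique cf fg; case: (fw) => _ lw _; split => //.
apply: ae_eq_L2 Lg _; first by case: lw.
by apply: filterS ae => x ->.
Qed.

Lemma Loo_normP f M : (Loo_norm f <= M%:E)%E -> {ae mu, forall x, `|f x| <= M}.
Proof.
(* The L^oo norm is the essential supremum only on a space of positive measure; [0, 1] witnesses
   this. *)
rewrite /Loo_norm unlock ifT; last first.
  apply: (@lt_le_trans _ _ (mu (`[0, 1]%classic : set R))).
    by rewrite lebesgue_measure_itv /= lte_fin ltr01 sube0 lte_fin.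
  by apply: le_measure; rewrite ?inE.
by move/ess_supP; apply: filterS => x /=; rewrite lee_fin.
Qed.

Lemma W1oo_normP f M : (W1oo_norm f <= M%:E)%E ->
  {ae mu, forall x, `|f x| <= M} /\
  {ae mu, forall x, `|weak_derive f x| <= M}.
Proof.
move=> fM; split; apply: Loo_normP; apply: le_trans fM.
  by rewrite leeDl // Lnorm_ge0.
by rewrite leeDr // Lnorm_ge0.
Qed.

Lemma L2_norm_le_H1_norm f : L2 f -> (L2_norm f <= H1_norm f)%E.
Proof.
move=> Lf; rewrite /H1_norm L2_normE //.
have s0 := sq_ge0 f.
rewrite -EFin_expe sqr_sqrtr //.
have -> : (Num.sqrt (sq f))%:E = ((sq f)%:E `^ 2^-1)%E.
  by rewrite poweR_EFin powR12_sqrt.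
have b0 : (0 <= L2_norm (weak_derive f) ^+ 2)%E.
  by rewrite expe_ge0 // Lnorm_ge0.
apply: gt0_ler_poweR; rewrite ?invr_ge0 ?in_itv /= ?leey ?andbT ?lee_fin //.
  by rewrite adde_ge0 ?lee_fin.
by rewrite leeDl.
Qed.

Lemma H1_normE f : L2 f -> L2 (weak_derive f) ->
  H1_norm f = (Num.sqrt (sq f + sq (weak_derive f)))%:E.
Proof.
move=> Lf Lw; rewrite /H1_norm !L2_normE // -!EFin_expe !sqr_sqrtr ?sq_ge0 //.
by rewrite -EFinD poweR_EFin powR12_sqrt // addr_ge0 // sq_ge0.
Qed.

(* Pointwise bounds survive L^2 limits: on a short interval to the right of 0
   where F exceeds B by d/2, so does |W - F|. *)
Lemma bound_of_L2_limit (F : R -> R) (B : R) : {for 0, continuous F} ->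
  measurable_fun setT F ->
  (forall e, 0 < e -> exists W : R -> R,
    [/\ forall z, `|W z| <= B, L2 (fun z => W z - F z) &
        sq (fun z => W z - F z) < e]) -> `|F 0| <= B.
Proof.
move=> cF mF H; rewrite leNgt; apply/negP => BF.
pose d := `|F 0| - B; have d0 : 0 < d by rewrite subr_gt0.
have [r /= r0 rP] : \forall z \near (0 : R), `|F 0 - F z| < d / 2.
  have /cvgrPdist_lt := cF; apply; exact: divr_gt0.
have rd0 : 0 < r / 2 * (d / 2) ^+ 2 by rewrite mulr_gt0 ?exprn_gt0 ?divr_gt0.
have [W [WB LW WF]] := H _ rd0.
have r20 : 0 <= r / 2 by rewrite divr_ge0 // ltW.
suff : r / 2 * (d / 2) ^+ 2 <= sq (fun z => W z - F z).
  by rewrite leNgt WF.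
have -> : r / 2 * (d / 2) ^+ 2 =
    \int[mu]_z ((d / 2) ^+ 2 * \1_(`[0, r / 2]%classic) z).
  rewrite RintegralZl //; last exact: integ_indic_itv.
  by rewrite Rintegral_indic_itv // subr0 mulrC.
apply: le_Rintegral => //.
- exact/integZ/integ_indic_itv.
- exact: LW.2.
move=> z _; rewrite indicE mem_setE.
case: (boolP (z \in `[0, r / 2])) => [|_]; last by rewrite mulr0 sqr_ge0.
rewrite in_itv /= => /andP[z0 zr]; rewrite mulr1.
have zF : `|F 0 - F z| < d / 2.
  by apply: rP => /=; rewrite sub0r normrN ger0_norm //; lra.
have dWF : d / 2 <= `|W z - F z|.
  have := WB z; have := ler_normB (F 0 - F z) (- (F z)).
  have := ler_normD (F 0 - F z) (F z - W z); rewrite addrA subrK.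
  have := ler_normD (F 0 - W z) (W z); rewrite subrK [`|W z - F z|]distrC.
  rewrite /d in zF *; lra.
by rewrite -[leRHS]real_normK ?num_real // lerXn2r // nnegrE // divr_ge0 // ltW.
Qed.

(** Both conclusions reduce to a bound at the origin, for the translate z |-> f (z + x) and for z
    |-> f (z + y) - f (z + x). *)
Lemma lipschitz_of_L2_limit f M : continuous f -> L2 f ->
  (forall e, 0 < e -> exists w : R -> R,
    [/\ forall x, `|w x| <= M, forall x y, `|w y - w x| <= M * `|y - x|,
     L2 w & sq (fun x => w x - f x) < e]) ->
  (forall x, `|f x| <= M) /\ (forall x y, `|f y - f x| <= M * `|y - x|).
Proof.
move=> cf Lf H.
have cfs c : continuous (fun z => f (z + c)).
  move=> z; apply: (@continuous_comp _ _ _ (fun z => z + c) f); last exact: cf.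
  by apply: cvgD; [exact: cvg_id|exact: cvg_cst].
split=> [x|x y].
  rewrite -[x]add0r; apply: (@bound_of_L2_limit (fun z => f (z + x))).
  - exact: cfs.
  - by apply: continuous_measurable_fun; exact: cfs.
  move=> e e0; have [w [wM _ Lw wf]] := H e e0.
  exists (fun z => w (z + x)); split => //.
    by apply: L2B; exact: L2_shift.
  by rewrite (sq_shift x (L2B Lw Lf)).
rewrite -[x]add0r -[y]add0r.
apply: (@bound_of_L2_limit (fun z => f (z + y) - f (z + x))).
- by apply: continuousB; exact: cfs.
- by apply: continuous_measurable_fun => z; apply: continuousB; exact: cfs.
(* Each of the two translated errors enters with a factor 2 from [sqD_le]. *)
move=> e e0; have e4 : 0 < e / 4 by rewrite divr_gt0.
have [w [_ wM Lw wf]] := H _ e4.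
exists (fun z => w (z + y) - w (z + x)).
have Ld := L2B Lw Lf.
have E : (fun z => w (z + y) - w (z + x) - (f (z + y) - f (z + x))) =
   (fun z => (w (z + y) - f (z + y)) + -1 * (w (z + x) - f (z + x))).
  by apply/funext => z; ring.
split.
- move=> z; apply: le_trans (wM _ _) _.
  by rewrite !add0r (_ : z + y - (z + x) = y - x) //; ring.
- by apply: L2B; apply: L2B; exact: L2_shift.
rewrite E; apply: le_lt_trans (sqD_le _ _) _.
- exact: (L2_shift y Ld).
- exact: (L2Z (-1) (L2_shift x Ld)).
rewrite sqZ; last exact: (L2_shift x Ld).
by rewrite (sq_shift y Ld) (sq_shift x Ld); lra.
Qed.

(** Truncating g to [-M, M] changes it on a null set only, so f keeps the same increments. *)
Lemma clip_primitive M f g : 0 <= M -> measurable_fun setT g ->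
  primitive f g -> {ae mu, forall x, `|g x| <= M} ->
  exists2 k, bounded_primitive M f k & {ae mu, forall x, g x = k x}.
Proof.
move=> M0 mg fg gM; pose k x := Num.max (- M) (Num.min M (g x)).
have gk : {ae mu, forall x, g x = k x}.
  apply: filterS gM => x; rewrite ler_norml => /andP[Mg gM].
  by rewrite /k (min_idPr gM) (max_idPr Mg).
have mk : measurable_fun setT k.
  by apply: measurable_maxr => //; exact: measurable_minr.
exists k => //; split => //.
  move=> x; rewrite ler_norml /k le_max lexx /= ge_max ge_min lexx /=.
  by rewrite (le_trans _ M0) // oppr_le0.
move=> x y xy; rewrite fg //; rewrite /Rintegral; congr fine.
apply: ae_eq_integral => //.
- by apply/measurable_EFinP; exact: measurable_funTS.
- by apply/measurable_EFinP; exact: measurable_funTS.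
by apply: filterS gk => z -> _.
Qed.

Lemma primitive_lipschitz_ae_le M f g : locally_integrable setT g ->
  primitive f g -> (forall x y, `|f y - f x| <= M * `|y - x|) ->
  {ae mu, forall x, `|g x| <= M}.
Proof.
move=> lg fg fM; apply: filterS (diff_quot_ae_cvg lg fg) => x cx.
have cn : `|diff_quot n.+1%:R^-1 f x| @[n --> \oo] --> `|g x|.
  exact: cvg_norm cx.
rewrite leNgt; apply/negP => Mg.
have [n] := filter_ex (cvgr_gt _ cn _ Mg).
apply/negP; rewrite -leNgt /diff_quot normrM gtr0_norm ?invr_gt0 ?ltr0n //.
have r0 : 0 < n.+1%:R^-1 :> R by rewrite invr_gt0 ltr0n.
rewrite ler_pdivrMl // mulrC.
by have := fM x (x + n.+1%:R^-1); rewrite [x + _]addrC addrK (gtr0_norm r0).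
Qed.

End Representatives.

(** * Persistence of zeros in time *)

Section Solution.
Context {R : realType}.
Notation mu := (@lebesgue_measure R).
Context (T : R) (u0 : R -> R) (u ut : R -> R -> R).
Context (T_gt0 : 0 < T) (hu : CH_solution T u0 u ut).
Implicit Types (s t x y h M : R).

Let L2u t : t \in `[- T, T] -> L2 (u t).
Proof.
move=> tT; have [+ _] := CH_C_H1 hu tT.
by move=> /(in_H1P (CH_continuous hu tT))[].
Qed.

Let itv_oo_cc t : t \in `]- T, T[ -> t \in `[- T, T].
Proof. exact: subset_itv_oo_cc. Qed.

Lemma CH_near_sq t e : t \in `[- T, T] -> 0 < e ->
  exists2 d, 0 < d & forall s, s \in `[- T, T] -> `|s - t| < d ->
    sq (fun x => u s x - u t x) < e.
Proof.
move=> tT e0; have [_ c] := CH_C_H1 hu tT.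
have e1 : (0 < (Num.sqrt e)%:E)%E by rewrite lte_fin sqrtr_gt0.
have [d /= d0 dP] := c _ (open_ereal_lt' e1).
exists d => // s sT std.
have Ld : L2 (fun x => u s x - u t x) by exact: L2B (L2u sT) (L2u tT).
have H : (H1_norm (u s \- u t)%R < (Num.sqrt e)%:E)%E.
  by apply: dP => //=; rewrite distrC.
have := le_lt_trans (L2_norm_le_H1_norm Ld) H.
by rewrite L2_normE // lte_fin ltr_sqrt.
Qed.

Lemma CH_near_H1 t : t \in `[- T, T] -> (forall x, u t x = 0) ->
  exists2 d, 0 < d & forall s, s \in `[- T, T] -> `|s - t| < d ->
    sq (u s) + sq (weak_derive (u s)) <= 1.
Proof.
move=> tT ut0; have [_ c] := CH_C_H1 hu tT.
have [d /= d0 dP] := c _ (open_ereal_lt' lte01).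
exists d => // s sT std.
have [+ _] := CH_C_H1 hu sT.
move=> /(in_H1P (CH_continuous hu sT))[L1 Lw _ _].
have : (H1_norm (u s \- u t)%R < 1%:E)%E.
  by apply: dP => //=; rewrite distrC.
have -> : u s \- u t = u s by apply/funext => x /=; rewrite ut0 subr0.
rewrite H1_normE // lte_fin -[ltRHS]sqrtr1 ltr_sqrt //; exact: ltW.
Qed.

(** Times s > t at which the W^{1,oo} bound holds accumulate at every t, and u s -> u t in L^2; sup
    and Lipschitz bounds survive this limit. *)
Lemma CH_uniform_bound : exists2 M, 0 <= M & forall t, t \in `]- T, T[ ->
  (forall x, `|u t x| <= M) /\ (forall x y, `|u t y - u t x| <= M * `|y - x|).
Proof.
have [M HM] := CH_Loo_W1oo hu; exists `|M| => // t tT.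
have tT' := itv_oo_cc tT.
apply: (lipschitz_of_L2_limit (CH_continuous hu tT') (L2u tT')).
move=> e e0; have [d d0 dP] := CH_near_sq tT' e0.
move: (tT); rewrite in_itv /= => /andP[t1 t2].
have tm : t < Num.min (t + d) T by rewrite lt_min t2 ltrDl d0.
have [s] := ae_exists_itv HM tm.
rewrite in_itv /= lt_min => /andP[ts /andP[sd sT]] Hs.
have sT' : s \in `[- T, T] by rewrite in_itv /= !ltW // (lt_trans t1).
have cs := CH_continuous hu sT'.
have [_ /W1oo_normP[uM wM]] := Hs sT'.
have [H1 _] := CH_C_H1 hu sT'.
have [Ls Lw lw pw] := in_H1P cs H1.
have MM : M <= `|M| by exact: ler_norm.
exists (u s); split => //.
- by move=> x; apply: le_trans (continuous_ae_norm_le cs uM x) MM.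
- have wM' : {ae mu, forall x, `|weak_derive (u s) x| <= `|M|}.
    by apply: filterS wM => z /le_trans; apply.
  have [k kP _] := clip_primitive (normr_ge0 M) (L2_measurable Lw) pw wM'.
  by move=> x y; exact: bprim_lipschitz kP.
- by apply: dP => //; rewrite gtr0_norm ?subr_gt0 // ltrBlDl.
Qed.

(** This trades the chosen weak derivative for one bounded by M everywhere; the equation survives
    since the two agree off a null set, also under the convolution integral. *)
Lemma CH_slice M t : 0 <= M -> t \in `]- T, T[ ->
  (forall x, `|u t x| <= M) -> (forall x y, `|u t y - u t x| <= M * `|y - x|) ->
  exists g, [/\ bounded_primitive M (u t) g, L2 g,
    sq (weak_derive (u t)) = sq g &
    {ae mu, forall x, ut t x + u t x * g x
     + convolution CH_kernel (fun y => u t y ^+ 2 + 2^-1 * g y ^+ 2) x = 0}].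
Proof.
move=> M0 tT uM uL; have tT' := itv_oo_cc tT.
have ct := CH_continuous hu tT'.
have [H1 _] := CH_C_H1 hu tT'; have [Lu Lw lw pw] := in_H1P ct H1.
have wM := primitive_lipschitz_ae_le lw pw uL.
have [g gP wg] := clip_primitive M0 (L2_measurable Lw) pw wM.
have mg := bprim_measurable gP; have mw := L2_measurable Lw.
have mu' := L2_measurable Lu.
exists g; split => //.
- exact: ae_eq_L2 Lw wg.
- exact: ae_eq_sq.
have H := CH_equation hu tT; have wg' := wg.
apply: filterS2 wg H => x <- <-; congr (_ + _); rewrite /convolution.
have mkx : measurable_fun setT (fun y => CH_kernel (x - y)).
  exact: (measurableT_comp measurable_CH_kernel (measurable_reflect x)).
apply: ae_eq_Rintegral.
- apply: measurable_funM => //; apply: measurable_funD; first exact: measurable_funX.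
  by apply: measurable_funM => //; exact: measurable_funX.
- apply: measurable_funM => //; apply: measurable_funD; first exact: measurable_funX.
  by apply: measurable_funM => //; exact: measurable_funX.
by apply: filterS wg' => y ->.
Qed.

Lemma CH_L2_derive t : t \in `]- T, T[ ->
  L2 (ut t) /\
  sq (fun x => h^-1 * (u (t + h) x - u t x) - ut t x) @[h --> 0^'] --> 0.
Proof.
move=> tT; have [/Lfun2P Lu /Lfun2P Lut c _] := CH_C1_L2 hu tT; split => //.
apply: cvg_L2_norm_sq c.
have nT : \forall h \near (0 : R)^', t + h \in `]- T, T[.
  have c0 : t + h @[h --> (0 : R)] --> t.
    by rewrite -[X in _ --> X]addr0; apply: cvgD; [exact: cvg_cst|exact: cvg_id].
  exact: nbhs_dnbhs (c0 _ (near_in_itvoo tT)).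
apply: filterS nT => h /itv_oo_cc thT.
by apply: L2B => //; apply: L2Z; apply: L2B => //; exact: L2u.
Qed.

Lemma CH_zero_open t : t \in `]- T, T[ -> (forall x, u t x = 0) ->
  \forall s \near t, forall x, u s x = 0.
Proof.
move=> tT utz; have tT' := itv_oo_cc tT.
have [M M0 HM] := CH_uniform_bound.
have [C C0 HC] := energy_derivative_le M.
have [d1 d10 d1P] := CH_near_H1 tT' utz.
have [d2 /= d20 d2P] : \forall s \near t, s \in `]- T, T[.
  exact: near_in_itvoo.
(* d1 gives the initial bound E <= 1, d2 keeps the times inside ]-T, T[, and (2 C)^-1 produces the
   factor 1/2. None of them depends on the bound B being improved. *)
pose d := Num.min (Num.min d1 d2) (2 * C)^-1.
have d0 : 0 < d by rewrite !lt_min d10 d20 invr_gt0 mulr_gt0.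
have dd1 : d <= d1 by rewrite /d !ge_min lexx.
have dd2 : d <= d2 by rewrite /d !ge_min lexx orbT.
have dC : C * d <= 2^-1.
  have : d <= (2 * C)^-1 by rewrite /d ge_min lexx orbT.
  rewrite -(ler_pM2l C0) => /le_trans; apply.
  by rewrite invfM mulrCA mulfV ?mulr1 // gt_eqF.
have sT s : `|s - t| < d -> s \in `]- T, T[.
  by move=> sd; apply: d2P => /=; rewrite distrC (lt_le_trans sd).
pose E s := sq (u s) + sq (weak_derive (u s)).
have step B : (forall s, `|s - t| < d -> E s <= B) ->
    forall s, `|s - t| < d -> E s <= B / 2.
  move=> EB s sd; have sT' := sT s sd.
  have [uM uL] := HM s sT'.
  have [g [gP Lg wg eqg]] := CH_slice M0 sT' uM uL.
  have Ls := L2u (itv_oo_cc sT').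
  have B0 : 0 <= B.
    by apply: le_trans (EB s sd); rewrite addr_ge0 ?sq_ge0.
  (* A bound on E_h uniform in h passes to E by [sq_le_diff_quot]. *)
  suff H h : 0 < h -> h <= 1 -> sq (u s) + sq (diff_quot h (u s)) <= B / 2.
    rewrite /E wg -lerBrDl; apply: sq_le_diff_quot gP Ls Lg _ => n.
    rewrite lerBrDl; apply: H; first by rewrite invr_gt0 ltr0n.
    by rewrite invf_le1 ?ler1n // ltr0n.
  move=> h0 h1.
  pose phi r := sq (u r) + sq (diff_quot h (u r)).
  pose phi' r := 2 * ip (u r) (ut r) +
      2 * ip (diff_quot h (u r)) (diff_quot h (ut r)).
  have dphi r : `|r - t| < d -> is_derive r 1 phi (phi' r).
    move=> rd; have rT := sT r rd.
    have nL : \forall w \near r, L2 (u w).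
      have nr : \forall w \near r, w \in `]- T, T[ by exact: near_in_itvoo.
      by apply: filterS nr => w /itv_oo_cc /L2u.
    have [Lur cr] := CH_L2_derive rT.
    apply: is_deriveD; first exact: sq_derive.
    apply: (sq_derive (U := fun w => diff_quot h (u w))).
    - by apply: filterS nL => w; exact: L2_diff_quot.
    - exact: L2_diff_quot.
    have nk : \forall k \near (0 : R)^', L2 (u (r + k)).
      have c0 : r + k @[k --> (0 : R)] --> r.
        by rewrite -[X in _ --> X]addr0; apply: cvgD; [exact: cvg_cst|exact: cvg_id].
      exact: nbhs_dnbhs (c0 _ nL).
    pose D k x := k^-1 * (u (r + k) x - u r x) - ut r x.
    (* For fixed h, D_h is bounded on L^2 and commutes with differentiation in time, so t |-> D_h
       u(t) is differentiable in L^2 as well. *)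
    have cD : h^-1 ^+ 2 * 4 * sq (D k) @[k --> (0 : R)^'] --> 0.
      rewrite -[X in _ --> X](mulr0 (h^-1 ^+ 2 * 4)).
      by apply: cvgM => //; exact: cvg_cst.
    apply: (squeeze_cvgr _ (cvg_cst 0) cD).
    apply: filterS nk => k Lk; rewrite sq_ge0 /=.
    have -> : (fun x => k^-1 * (diff_quot h (u (r + k)) x - diff_quot h (u r) x)
        - diff_quot h (ut r) x) = diff_quot h (D k).
      by apply/funext => x; rewrite /diff_quot /D; ring.
    apply: sq_diff_quot_le_inv; apply: L2B => //; apply: L2Z; apply: L2B => //.
    exact: nbhs_singleton nL.
  have bphi r : `|r - t| < d -> `|phi' r| <= C * B.
    move=> rd; have rT := sT r rd; have [uM' uL'] := HM r rT.
    have [k [kP Lk wk eqk]] := CH_slice M0 rT uM' uL'.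
    have [Lur _] := CH_L2_derive rT.
    apply: le_trans (HC (u r) k (ut r) h h0 h1 kP uM' (L2u (itv_oo_cc rT)) Lk Lur eqk) _.
    by rewrite ler_pM2l // -wk; exact: EB.
  have phit : phi t = 0.
    have utE : u t = (fun=> 0) by apply/funext.
    rewrite /phi utE /sq /diff_quot.
    under eq_Rintegral do rewrite expr0n.
    under [X in _ + X]eq_Rintegral do rewrite subrr mulr0 expr0n.
    by rewrite Rintegral_cst // mul0r addr0.
  have CB : 0 <= C * B by rewrite mulr_ge0 // ltW.
  have := lipschitz_of_derive CB dphi bphi sd.
  rewrite phit subr0 => H; apply: le_trans (ler_norm _) _.
  apply: le_trans H _; apply: (@le_trans _ _ (C * B * d)).
    by rewrite ler_wpM2l ?mulr_ge0 // ltW.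
  by rewrite mulrAC mulrC ler_wpM2l.
have En n s : `|s - t| < d -> E s <= 2^-1 ^+ n.
  elim: n s => [|n IH] s sd; last by rewrite exprSr; exact: step.
  rewrite expr0; apply: d1P; first exact: itv_oo_cc (sT s sd).
  exact: lt_le_trans sd dd1.
exists d => // s /=; rewrite distrC => sd.
have sT' := itv_oo_cc (sT s sd).
apply: (continuous_sq_eq0 (CH_continuous hu sT') (L2u sT')).
apply/eqP; rewrite eq_le sq_ge0 andbT leNgt; apply/negP => us0.
(* If [sq (u s)] were positive, some 2^-n would fall below it, against E s <= 2^-n. *)
have [n _ /(_ n (leqnn n))] := near_infty_natSinv_expn_lt (PosNum us0).
rewrite /= ltNge => /negP; apply; apply: le_trans (_ : E s <= _).
  by rewrite /E lerDl sq_ge0.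
by rewrite div1r -exprVn; exact: En.
Qed.

Lemma CH_zero_closed t : t \in `[- T, T] ->
  (forall d, 0 < d -> exists s, [/\ s \in `[- T, T], `|s - t| < d &
     forall x, u s x = 0]) -> forall x, u t x = 0.
Proof.
move=> tT H; apply: (continuous_sq_eq0 (CH_continuous hu tT) (L2u tT)).
apply/eqP; rewrite eq_le sq_ge0 andbT leNgt; apply/negP => u0'.
(* The tolerance is [sq (u t)] itself, which is exactly the squared distance from u t to a vanishing
   slice. *)
have [d d0 dP] := CH_near_sq tT u0'.
have [s [sT sd us]] := H d d0; have := dP s sT sd.
have -> : (fun x => u s x - u t x) = (fun x => -1 * u t x).
  by apply/funext => x; rewrite us; ring.
by rewrite sqZ; [rewrite expr2 mulrNN !mul1r ltxx|exact: L2u].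
Qed.

(** The zero times are relatively open and closed in the connected interval ]-T, T[. Openness is
    available only there, so the endpoints are reached afterwards by closedness. *)
Lemma CH_zero_global t0 : t0 \in `]- T, T[ -> (forall x, u t0 x = 0) ->
  forall t x, t \in `[- T, T] -> u t x = 0.
Proof.
move=> t0T ut0z.
pose Z := [set t | forall x, u t x = 0].
pose A := `]- T, T[%classic : set R.
have AZ : A `&` Z = A.
  have cA : connected A by apply/connected_intervalP; exact: interval_is_interval.
  apply: cA.
  - by exists t0; split.
  - exists (interior Z); first exact: open_interior.
    apply/seteqP; split => s [As Zs]; split => //.
      by apply: CH_zero_open.
    exact: interior_subset.
  - exists (closure Z); first exact: closed_closure.
    apply/seteqP; split => s [As Zs]; split => //; first exact: subset_closure.
    apply: CH_zero_closed; first exact: itv_oo_cc.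
    move=> d d0.
    have nA : \forall z \near s, z \in `]- T, T[ by exact: near_in_itvoo.
    have nd : \forall z \near s, `|z - s| < d.
      by exists d => // z /=; rewrite distrC.
    have [z [Zz [zA zd]]] := Zs _ (filterI nA nd).
    by exists z; split => //; exact: itv_oo_cc.
have Aoo t : t \in `]- T, T[ -> forall x, u t x = 0.
  by move=> tT; have : A t by []; rewrite -AZ => -[].
move=> t x tT; move: x; apply: CH_zero_closed => // d d0.
(* The time t (1 - c) is t pulled towards 0: it lies in the open interval since 0 < c < 1, and it
   moves by at most T c <= d / 2. *)
pose c := Num.min 2^-1 (d / (2 * T)).
have c0 : 0 < c.
  by rewrite lt_min; apply/andP; split; [rewrite invr_gt0|rewrite divr_gt0 ?mulr_gt0].
have c1 : c <= 2^-1 by rewrite /c ge_min lexx.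
have cd : c * (2 * T) <= d.
  by rewrite -ler_pdivlMr ?mulr_gt0 // /c ge_min lexx orbT.
move: (tT); rewrite in_itv /= => /andP[t1 t2].
have sT : t * (1 - c) \in `]- T, T[.
  have Tc : 0 < T * c by rewrite mulr_gt0.
  have p1 : 0 <= (t + T) * (1 - c) by rewrite mulr_ge0 //; lra.
  have p2 : 0 <= (T - t) * (1 - c) by rewrite mulr_ge0 //; lra.
  by rewrite in_itv /=; apply/andP; split; lra.
exists (t * (1 - c)); split; [exact: itv_oo_cc| |exact: Aoo].
have -> : t * (1 - c) - t = - (t * c) by ring.
rewrite normrN normrM (gtr0_norm c0).
have tT' : `|t| <= T by rewrite ler_norml t1.
have p3 : `|t| * c <= T * c by rewrite ler_wpM2r // ltW.
have Tc : 0 < T * c by rewrite mulr_gt0.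
by apply: lt_le_trans cd; lra.
Qed.

End Solution.

(** * Solutions vanishing on an interval *)

Section UniqueContinuation.
Context {R : realType}.
Notation mu := (@lebesgue_measure R).
Implicit Types (f g G : R -> R) (a b x y : R).

(* For x in the gap [a, b] the kernel K(x - y) splits as - e^-x e^y / 2 to the
   left of the gap and as e^x e^-y / 2 to its right. *)
Let left_weight a y : R := expR y * \1_(`]-oo, a]%classic) y.
Let right_weight b y : R := expR (- y) * \1_(`[b, +oo[%classic) y.

Let measurable_left_weight a : measurable_fun setT (left_weight a).
Proof.
apply: measurable_funM; first exact: measurable_expR.
exact: measurable_indic.
Qed.

Let measurable_right_weight b : measurable_fun setT (right_weight b).
Proof.
apply: measurable_funM; last exact: measurable_indic.
by apply: measurableT_comp; [exact: measurable_expR|exact: measurable_funN].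
Qed.

Let left_weight_ge0 a y : 0 <= left_weight a y.
Proof. by rewrite mulr_ge0 ?expR_ge0 // indicE ler0n. Qed.

Let right_weight_ge0 b y : 0 <= right_weight b y.
Proof. by rewrite mulr_ge0 ?expR_ge0 // indicE ler0n. Qed.

Let left_weight_le a y : `|left_weight a y| <= expR a.
Proof.
rewrite ger0_norm ?left_weight_ge0 // /left_weight indicE mem_setE in_itv /=.
by case: (leP y a) => ya; rewrite ?mulr1 ?mulr0 ?expR_ge0 // ler_expR.
Qed.

Let right_weight_le b y : `|right_weight b y| <= expR (- b).
Proof.
rewrite ger0_norm ?right_weight_ge0 // /right_weight indicE mem_setE in_itv /=.
rewrite andbT; case: (leP b y) => yb; rewrite ?mulr1 ?mulr0 ?expR_ge0 //.
by rewrite ler_expR lerN2.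
Qed.

Let left_mass a G : R := \int[mu]_y (left_weight a y * G y).
Let right_mass b G : R := \int[mu]_y (right_weight b y * G y).

Lemma convolution_CH_kernel_gap a b G x : a < b -> integ G ->
  {ae mu, forall y, y \in `[a, b] -> G y = 0} -> x \in `[a, b] ->
  convolution CH_kernel G x =
  2^-1 * expR x * right_mass b G - 2^-1 * expR (- x) * left_mass a G.
Proof.
move=> ab iG G0; rewrite in_itv /= => /andP[ax xb].
have il : integ (fun y => left_weight a y * G y) by exact: integ_boundM iG _.
have ir : integ (fun y => right_weight b y * G y) by exact: integ_boundM iG _.
rewrite /left_mass /right_mass -!RintegralZl //.
rewrite -RintegralB //; [|exact: integZ|exact: integZ].
have mG := integ_measurable iG.
apply: ae_eq_Rintegral.
- apply: measurable_funM => //.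
  exact: (measurableT_comp measurable_CH_kernel (measurable_reflect x)).
- by apply: measurable_funB; apply: measurable_funM => //; apply: measurable_funM.
apply: filterS G0 => y; rewrite in_itv /= => G0.
have [ya|ay] := leP a y; last first.
  have yx : 0 < x - y by rewrite subr_gt0 (lt_le_trans ay).
  rewrite /left_weight /right_weight !indicE !mem_setE !in_itv /= andbT.
  rewrite (ltW ay) leNgt (lt_trans ay ab) /= /CH_kernel gtr0_sg // gtr0_norm //.
  by rewrite opprB addrC expRD; ring.
have [yb|by_] := leP y b.
  rewrite G0 ?ya ?yb // !mulr0; ring.
have yx : x - y < 0 by rewrite subr_lt0 (le_lt_trans xb).
rewrite /left_weight /right_weight !indicE !mem_setE !in_itv /= andbT.
rewrite (ltW by_) leNgt (lt_trans ab by_) /= /CH_kernel ltr0_sg // ltr0_norm //.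
by rewrite opprK expRD; ring.
Qed.

(** The sum of the two weights is positive exactly outside ]a, b[, and its product with G has
    integral 0. *)
Lemma mass_eq0 a b G : integ G -> (forall y, 0 <= G y) ->
  left_mass a G + right_mass b G = 0 ->
  {ae mu, forall y, y \notin `]a, b[ -> G y = 0}.
Proof.
move=> iG G0 H.
have il : integ (fun y => left_weight a y * G y) by exact: integ_boundM iG _.
have ir : integ (fun y => right_weight b y * G y) by exact: integ_boundM iG _.
have is_ := integD il ir.
have s0 y : 0 <= left_weight a y * G y + right_weight b y * G y.
  by rewrite addr_ge0 // mulr_ge0.
have : (\int[mu]_y `|(left_weight a y * G y + right_weight b y * G y)%:E| = 0)%E.
  under eq_integral do rewrite gee0_abs ?lee_fin //.
  rewrite -[LHS]fineK; last exact: integrable_fin_num.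
  rewrite -[X in X%:E]/(\int[mu]_y (left_weight a y * G y + right_weight b y * G y)).
  by rewrite RintegralD // -/(left_mass a G) -/(right_mass b G) H.
move/(ae_eq_integral_abs mu measurableT (measurable_int mu is_)).
apply: filterS => y /(_ I)[] /eqP; rewrite -mulrDl mulf_eq0 => /orP[|/eqP//].
rewrite paddr_eq0 // => /andP[]; rewrite /left_weight /right_weight.
rewrite !mulf_eq0 (gt_eqF (expR_gt0 y)) (gt_eqF (expR_gt0 (- y))) /=.
rewrite !indicE !mem_setE !in_itv /= ?andbT.
by case: (leP y a) => ?; case: (leP b y) => ? /=; rewrite ?oner_eq0.
Qed.

Lemma gap_strictly_decreasing (A B : R) : 0 <= A -> 0 <= B -> 0 < A + B ->
  forall x y, x < y ->
  expR (- y) * A - expR y * B < expR (- x) * A - expR x * B.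
Proof.
move=> A0 B0 AB x y xy.
have e1 : expR (- y) < expR (- x) by rewrite ltr_expR ltrN2.
have e2 : expR x < expR y by rewrite ltr_expR.
have [A1|A1] := ltP 0 A.
  have := ler_wpM2r B0 (ltW e2); rewrite -(ltr_pM2r A1) in e1; lra.
have B1 : 0 < B by lra.
have := ler_wpM2r A0 (ltW e1); rewrite -(ltr_pM2r B1) in e2; lra.
Qed.

Lemma continuous_gap_profile (A B : R) :
  continuous (fun x : R => 2^-1 * (expR (- x) * A - expR x * B)).
Proof.
move=> x; apply: cvgM; first exact: cvg_cst.
apply: cvgB; apply: cvgM; try exact: cvg_cst.
  apply: (@continuous_comp _ _ _ -%R expR); first exact: opp_continuous.
  exact: continuous_expR.
exact: continuous_expR.
Qed.

Lemma CH_zero_slice (T : R) (u0 : R -> R) (u ut : R -> R -> R) (t a b : R) :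
  CH_solution T u0 u ut -> t \in `]- T, T[ -> a < b ->
  (forall x, x \in `[a, b] -> u t x = 0) ->
  ~ strictly_decreasing_on a b (ut t) -> forall x, u t x = 0.
Proof.
move=> hu tT ab uab hdec.
have tT' : t \in `[- T, T] by exact: subset_itv_oo_cc.
have cu := CH_continuous hu tT'; have [H1 _] := CH_C_H1 hu tT'.
have [Lu Lw lw pw] := in_H1P cu H1.
pose w := weak_derive (u t).
pose G y := u t y ^+ 2 + 2^-1 * w y ^+ 2.
have iG : integ G by apply: integD; [exact: Lu.2|exact: integZ Lw.2].
have G0 y : 0 <= G y by rewrite addr_ge0 ?sqr_ge0 // mulr_ge0 ?sqr_ge0.
(* For y < b the forward difference quotients of u at y are eventually 0. The endpoint b, from which
   they leave the gap, is discarded as a null set. *)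
have w0 : {ae mu, forall y, y \in `[a, b] -> w y = 0}.
  have nb : {ae mu, forall y, y != b}.
    exists [set b]; split => //; first exact: lebesgue_measure_set1.
    by move=> y /= /negP; rewrite negbK => /eqP.
  apply: filterS2 nb (diff_quot_ae_cvg lw pw) => y yb cy.
  rewrite in_itv /= => /andP[ay yb'].
  have yltb : y < b by rewrite lt_neqAle yb.
  apply: (cvg_unique _ cy (_ : _ --> (0 : R))); first exact: Rhausdorff.
  apply: cvg_near_cst.
  have d0 : 0 < b - y by rewrite subr_gt0.
  have := near_infty_natSinv_lt (PosNum d0); apply: filterS => n /= nd.
  have n0 : 0 < n.+1%:R^-1 :> R by rewrite invr_gt0 ltr0n.
  move: nd n0; set r := n.+1%:R^-1 => nd n0.
  rewrite /diff_quot (uab y) ?(uab (y + r)) ?subrr ?mulr0 ?in_itv /= ?ay ?ltW //.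
    by rewrite -ltrBrDl.
  by rewrite (le_lt_trans ay) // ltrDl.
have Gab : {ae mu, forall y, y \in `[a, b] -> G y = 0}.
  apply: filterS w0 => y wy yab; rewrite /G wy // uab // !expr0n /=.
  by rewrite mulr0 addr0.
pose A := left_mass a G; pose B := right_mass b G.
have A0 : 0 <= A by apply: Rintegral_ge0 => y _; rewrite mulr_ge0.
have B0 : 0 <= B by apply: Rintegral_ge0 => y _; rewrite mulr_ge0.
have [AB|AB] := ltP 0 (A + B).
  exfalso; apply: hdec.
  (* The explicit profile is the continuous representative of [ut t] on [a, b]: there the transport
     term drops and the convolution is known in closed form. *)
  exists (fun x => 2^-1 * (expR (- x) * A - expR x * B)); split.
  - exact/continuous_subspaceT/continuous_gap_profile.
  - apply: filterS (CH_equation hu tT) => x eqx xab.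
    move: eqx; rewrite uab // mul0r addr0 -/w -/G.
    rewrite (convolution_CH_kernel_gap ab iG Gab xab) -/A -/B => eqx.
    by apply/eqP; rewrite -subr_eq0 -[X in _ == X]eqx; apply/eqP; ring.
  - by move=> x y _ _ xy; rewrite ltr_pM2l ?invr_gt0 //; exact: gap_strictly_decreasing.
have AB0 : A + B = 0 by apply/eqP; rewrite eq_le AB addr_ge0.
have Gae := mass_eq0 iG G0 AB0.
(* Off the gap G = 0 forces u = 0 almost everywhere, since G is a sum of two nonnegative terms; in
   the gap this is the hypothesis. *)
have uae : {ae mu, forall y, `|u t y| <= 0}.
  apply: filterS Gae => y Gy; rewrite normr_le0.
  have [yab|yab] := boolP (y \in `]a, b[).
    by rewrite uab //; exact: subset_itv_oo_cc.
  have := Gy yab => /eqP; rewrite paddr_eq0 ?sqr_ge0 //; last first.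
    by rewrite mulr_ge0 ?sqr_ge0.
  by rewrite sqrf_eq0 => /andP[].
move=> x; apply/eqP; rewrite -normr_le0.
exact: continuous_ae_norm_le cu uae x.
Qed.

End UniqueContinuation.

Theorem theorem1p14 (R : realType) (T : R) (hT : 0 < T)
  (u0 : R -> R) (u ut : R -> R -> R) (hu : CH_solution T u0 u ut)
  (t0 : R) (ht0 : t0 \in `]- T, T[)
  (a b : R) (hab : a < b)
  (hzero : forall x : R, x \in `[a, b] -> u t0 x = 0)
  (hdec : ~ strictly_decreasing_on a b (ut t0)) :
  forall t x : R, t \in `[- T, T] -> u t x = 0.
Proof.
apply: (CH_zero_global hT hu ht0).
exact: CH_zero_slice hu ht0 hab hzero hdec.
Qed.
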